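(* Consider the following eventually periodic sequences in $\mathbb{Z}/2\mathbb{Z}$: $Q_1 = 0100(001001011100)^{\infty}$, $Q_2 = (010010000111)^{\infty}$, $Q_3 = 0101(011000011000)^{\infty}$, $Q_4 = 0101(101000101000)^{\infty}$, $R_1 = 001(010000100001)^{\infty}$, $R_2 = 0011110(001101010110)^{\infty}$, $R_3 = 010(000101000010)^{\infty}$, $R_4 = 0100001(010010111100001010111111)^{\infty}$, $R_5 = 0100001(100100001001)^{\infty}$, $R_6 = 0101011(010101100011)^{\infty}$, $R_7 = 0101011(010111111101011010011101)^{\infty}$, $R_8 = 010(101110110010)^{\infty}$, $R_9 = 100(001000010100)^{\infty}$, $R_{10} = 1000010(110001101010)^{\infty}$, $R_{11} = 1111101(011000110101)^{\infty}$, $R_{12} = 111(110110000111)^{\infty}$. Then their generating functions $\mathcal{G}_S(t)$ (for lifting from $\mathbb{Z}/2\mathbb{Z}$ to $\mathbb{Z}/4\mathbb{Z}$) are: $\mathcal{G}_{Q_1}(t) = 1 + 8t^{8} + 34t^{16} + 58t^{24} + 84t^{32} + 88t^{40} + 86t^{48} + 82t^{56} + 60t^{64} + 36t^{72} + 34t^{80} + 28t^{88} + 16t^{96} + \frac{2t^{104}}{1-t^{8}}$; $\mathcal{G}_{Q_2}(t) = 1 + 4t^{8} + 14t^{16} + 32t^{24} + 36t^{32} + 48t^{40} + 44t^{48} + 26t^{56} + 22t^{64} + 8t^{72} + 6t^{80} + 4t^{88} + 2t^{96}$; $\mathcal{G}_{Q_3}(t) = 1 + 8t^{8} + 28t^{16}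 + 46t^{24} + 78t^{32} + 124t^{40} + 118t^{48} + 96t^{56} + 78t^{64} + 60t^{72} + 28t^{80} + 20t^{88} + 14t^{96} + 10t^{104} + 4t^{112} + 6t^{120} + 4t^{128} + 6t^{136} + 4t^{144} + 2t^{152} + 2t^{160} + 2t^{168} + 2t^{176} + 2t^{184} + 2t^{192} + 2t^{200} + 4t^{208} + \frac{2t^{216}}{1-t^{8}}$; $\mathcal{G}_{Q_4}(t) = 1 + 8t^{8} + 26t^{16} + 42t^{24} + 66t^{32} + 62t^{40} + 52t^{48} + 36t^{56} + 26t^{64} + 12t^{72} + 6t^{80}$; $\mathcal{G}_{R_1}(t) = 0$, $\mathcal{G}_{R_2}(t)=0$; $\mathcal{G}_{R_3}(t) = 10t^7 + 38t^{15} + 70t^{23} + 88t^{31} + 76t^{39} + 54t^{47} + 44t^{55} + 28t^{63} + 16t^{71} + 8t^{79} + 4t^{87} + 4t^{95} + 4t^{103} + 4t^{111} + 4t^{119} + 6t^{127} + 4t^{135} + 6t^{143} + \frac{4t^{151}}{1-t^{8}}$; $\mathcal{G}_{R_4}(t) = 10t^7 + 52t^{15} + 102t^{23} + 136t^{31} + 152t^{39} + 118t^{47} + 108t^{55} + 80t^{63} + 60t^{71} + 32t^{79} + 20t^{87} + 8t^{95} + 2t^{103}$; $\mathcal{G}_{R_5}(t) = 10t^7$; $\mathcal{G}_{R_6}(t) = 10t^7 + 30t^{15} + 66t^{23} + 96t^{31} + 96t^{39} + 94t^{47} + 66t^{55} + 42t^{63} + 24t^{71} + 8t^{79} + 2t^{87}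 + 2t^{95}$; $\mathcal{G}_{R_7}(t) = 10t^7 + 60t^{15} + 138t^{23} + 204t^{31} + 304t^{39} + 266t^{47} + 246t^{55} + 148t^{63} + 64t^{71} + 36t^{79} + 14t^{87} + 10t^{95} + 8t^{103}$; $\mathcal{G}_{R_8}(t) = 10t^7$; $\mathcal{G}_{R_9}(t) = 10t^7 + 42t^{15} + 80t^{23} + 130t^{31} + 164t^{39} + 174t^{47} + 126t^{55} + 68t^{63} + 38t^{71} + 20t^{79} + 22t^{87} + 12t^{95} + 2t^{103} + 2t^{111} + 2t^{119} + 2t^{127} + 2t^{135} + 2t^{143} + 2t^{151} + 2t^{159} + 2t^{167} + 2t^{175} + 2t^{183} + 2t^{191} + 2t^{199} + 4t^{207} + \frac{2t^{215}}{1-t^8}$; $\mathcal{G}_{R_{10}}(t) = 10t^7 + 58t^{15} + 98t^{23} + 130t^{31} + 160t^{39} + 138t^{47} + 132t^{55} + 84t^{63} + 64t^{71} + 34t^{79} + 14t^{87} + 8t^{95} + 6t^{103} + 2t^{111} + 2t^{119} + 4t^{127} + \frac{2t^{135}}{1-t^8}$; $\mathcal{G}_{R_{11}}(t) = 4t^7 + 16t^{15} + 26t^{23} + 32t^{31} + 30t^{39} + 30t^{47} + 26t^{55} + 12t^{63} + 8t^{71} + 2t^{79}$; $\mathcal{G}_{R_{12}}(t)= 4t^{7}$.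
   Context: For a finite sequence $S=(x_{1,1},\dots,x_{1,n})$ in $\mathbb{Z}/N\mathbb{Z}$, the Steinhaus triangle $\nabla S$ is the triangular array $(x_{i,j})_{1\le i\le n,\,1\le j\le n+1-i}$ with $x_{i+1,j}=x_{i,j}+x_{i,j+1}$ mod $N$; it is balanced if all elements of $\mathbb{Z}/N\mathbb{Z}$ occur in it with equal multiplicity. $S[l]$ denotes the initial segment of length $l$ of a sequence $S$. For even $N$, $\nabla S$ with $S$ of length $n$ is strongly balanced if $\nabla S[n-2Nt]$ is balanced for every integer $0\le t\le n/(2N)$ (the empty triangle counts as balanced). Let $m$ be even and $\pi:\mathbb{Z}/2m\mathbb{Z}\to\mathbb{Z}/m\mathbb{Z}$ the canonical quotient map. For an infinite sequence $S$ in $\mathbb{Z}/m\mathbb{Z}$ and $n\ge0$, $a_n(S)$ is the number of sequences $T$ of length $n$ in $\mathbb{Z}/2m\mathbb{Z}$ such that $\nabla T$ is strongly balanced in $\mathbb{Z}/2m\mathbb{Z}$ and $\pi(T)=S[n]$ (termwise), and $\mathcal{G}_S(t)=\sum_{n\ge0}a_n(S)t^n$. Here $m=2$, so the lifts are to $\mathbb{Z}/4\mathbb{Z}$ and strong balance there refers to the segments $T[n-8t]$. $(W)^\infty$ denotes infinite repetition of the word $W$.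
   Formalization: As a_0(S)=1 always, the formulas fail for all sequences but Q_2, Q_4; they are proved for the part of G_S with exponents 0 mod 8 (Q_i) or 7 mod 8 (R_i), and each full G_S is given with its extra terms: 1 for every R_i, more terms for Q_1, Q_3, R_3 to R_8. *)

(* Defs.v *)
From HB Require Import structures.
From mathcomp Require Import all_boot all_order all_algebra.
From mathcomp Require Import boolp.

Set Implicit Arguments.
Unset Strict Implicit.
Unset Printing Implicit Defensive.

Import GRing.Theory.
Local Open Scope ring_scope.

Record fps (R : Type) := Fps { fpcoef : nat -> R }.

Lemma fps_eqP (R : Type) (F G : fps R) : fpcoef F =1 fpcoef G -> F = G.
Proof. by case: F G => [f] [g] /= /funext ->. Qed.

HB.instance Definition _ (R : Type) := gen_eqMixin (fps R).
HB.instance Definition _ (R : Type) := gen_choiceMixin (fps R).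

Section FpsRing.
Variable R : comUnitRingType.
Implicit Types F G H : fps R.

Definition fps_zero : fps R := Fps (fun=> 0).
Definition fps_opp F := Fps (fun n => - fpcoef F n).
Definition fps_add F G := Fps (fun n => fpcoef F n + fpcoef G n).

Fact fps_addA : associative fps_add.
Proof. by move=> F G H; apply: fps_eqP => n /=; rewrite addrA. Qed.
Fact fps_addC : commutative fps_add.
Proof. by move=> F G; apply: fps_eqP => n /=; rewrite addrC. Qed.
Fact fps_add0 : left_id fps_zero fps_add.
Proof. by move=> F; apply: fps_eqP => n /=; rewrite add0r. Qed.
Fact fps_addN : left_inverse fps_zero fps_opp fps_add.
Proof. by move=> F; apply: fps_eqP => n /=; rewrite addNr. Qed.

HB.instance Definition _ :=
  GRing.isZmodule.Build (fps R) fps_addA fps_addC fps_add0 fps_addN.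

Definition fps_one : fps R := Fps (fun n => (n == 0%N)%:R).
Definition fps_mul F G :=
  Fps (fun n => \sum_(i < n.+1) fpcoef F i * fpcoef G (n - i)%N).

Definition fps_trunc N F : {poly R} := \poly_(i < N) fpcoef F i.

Lemma coef_fps_trunc N F n : (n < N)%N -> (fps_trunc N F)`_n = fpcoef F n.
Proof. by move=> ltnN; rewrite coef_poly ltnN. Qed.

Lemma fpcoefM_trunc N F G n : (n < N)%N ->
  fpcoef (fps_mul F G) n = (fps_trunc N F * fps_trunc N G)`_n.
Proof.
move=> ltnN; rewrite coefM /=; apply: eq_bigr => -[i /= lein] _.
by rewrite !coef_fps_trunc ?(leq_ltn_trans _ ltnN) ?leq_subr.
Qed.

Fact fps_mulC : commutative fps_mul.
Proof.
move=> F G; apply: fps_eqP => n.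
by rewrite !(@fpcoefM_trunc n.+1) // mulrC.
Qed.
Fact fps_mulA : associative fps_mul.
Proof.
have assocl F G H n : fpcoef (fps_mul (fps_mul F G) H) n =
    (fps_trunc n.+1 F * fps_trunc n.+1 G * fps_trunc n.+1 H)`_n.
  rewrite coefM /=; apply: eq_bigr => -[i /= lein] _.
  rewrite coef_fps_trunc ?ltnS ?leq_subr //; congr (_ * _).
  exact: fpcoefM_trunc.
move=> F G H; apply: fps_eqP => n.
by rewrite assocl fps_mulC assocl mulrC mulrA.
Qed.
Fact fps_mul1 : left_id fps_one fps_mul.
Proof.
move=> F; apply: fps_eqP => n /=; rewrite big_ord_recl /= mul1r subn0.
by rewrite big1 ?addr0 // => i _; rewrite mul0r.
Qed.
Fact fps_mulDl : left_distributive fps_mul fps_add.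
Proof.
move=> F G H; apply: fps_eqP => n /=; rewrite -big_split /=.
by apply: eq_bigr => i _; rewrite mulrDl.
Qed.
Fact fps_one_neq0 : fps_one != 0.
Proof.
by apply/eqP => /(congr1 (fun F => fpcoef F 0)) /= /eqP; rewrite oner_eq0.
Qed.

HB.instance Definition _ := GRing.Zmodule_isComNzRing.Build (fps R)
  fps_mulA fps_mulC fps_mul1 fps_mulDl fps_one_neq0.

Lemma fpcoefD F G n : fpcoef (F + G) n = fpcoef F n + fpcoef G n.
Proof. by []. Qed.
Lemma fpcoefN F n : fpcoef (- F) n = - fpcoef F n.
Proof. by []. Qed.
Lemma fpcoefB F G n : fpcoef (F - G) n = fpcoef F n - fpcoef G n.
Proof. by []. Qed.
Lemma fpcoef1 n : fpcoef (1 : fps R) n = (n == 0%N)%:R.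
Proof. by []. Qed.
Lemma fpcoefM F G n :
  fpcoef (F * G) n = \sum_(i < n.+1) fpcoef F i * fpcoef G (n - i)%N.
Proof. by []. Qed.
Lemma fpcoef_sum I (r : seq I) (P : pred I) (E : I -> fps R) n :
  fpcoef (\sum_(i <- r | P i) E i) n = \sum_(i <- r | P i) fpcoef (E i) n.
Proof. exact: (big_morph (fun F => fpcoef F n)). Qed.

Lemma fpcoef0M F G : fpcoef (F * G) 0 = fpcoef F 0 * fpcoef G 0.
Proof. by rewrite fpcoefM big_ord1. Qed.

Lemma fpcoefX_small F k n : fpcoef F 0 = 0 -> (n < k)%N -> fpcoef (F ^+ k) n = 0.
Proof.
move=> F0; elim: k n => // k IHk n ltnk; rewrite exprS fpcoefM.
rewrite big_ord_recl /= F0 mul0r add0r big1 // => i _.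
rewrite IHk ?mulr0 //; case: n ltnk i => [_ []|n ltnk i] //.
by rewrite /= /bump add1n subSS (leq_ltn_trans (leq_subr _ _)).
Qed.

Definition fpsC (c : R) : fps R := Fps (fun n => if n is 0%N then c else 0).

Lemma fpcoefCM c F n : fpcoef (fpsC c * F) n = c * fpcoef F n.
Proof.
rewrite fpcoefM big_ord_recl /= subn0 big1 ?addr0 // => i _.
by rewrite mul0r.
Qed.

(* F^-1 = c * (1 + u + u^2 + ...), with c = F(0)^-1 and u = 1 - c F;
   the n-th coefficient only involves u^k for k <= n. *)
Definition fps_unit : {pred fps R} := [pred F | fpcoef F 0 \is a GRing.unit].
Definition fps_inv F : fps R :=
  if F \in fps_unit then
    let c := (fpcoef F 0)^-1 in let u := 1 - fpsC c * F in
    Fps (fun n => c * fpcoef (\sum_(k < n.+1) u ^+ k) n)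
  else F.

Fact fps_mulV : {in fps_unit, left_inverse 1 fps_inv *%R}.
Proof.
move=> F uF; rewrite /fps_inv uF; set c := _^-1; set u := 1 - _.
have u0 : fpcoef u 0 = 0 by rewrite fpcoefB fpcoefCM mulVr ?subrr.
pose g := Fps (fun n => fpcoef (\sum_(k < n.+1) u ^+ k) n).
have -> : Fps (fun n => c * fpcoef (\sum_(k < n.+1) u ^+ k) n) = fpsC c * g.
  by apply: fps_eqP => n; rewrite fpcoefCM.
rewrite mulrAC (_ : fpsC c * F = 1 - u); last by rewrite opprB addrC subrK.
apply: fps_eqP => n.
have -> : fpcoef ((1 - u) * g) n = fpcoef ((1 - u) * \sum_(k < n.+1) u ^+ k) n.
  rewrite !fpcoefM; apply: eq_bigr => -[i /= lein] _; congr (_ * _).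
  rewrite !fpcoef_sum -(subnKC (_ : (n - i).+1 <= n.+1)%N) ?ltnS ?leq_subr //.
  rewrite big_split_ord /= [X in _ = _ + X]big1 ?addr0 // => k _.
  by rewrite fpcoefX_small //= leq_addr.
rewrite -opprB mulNr -subrX1 opprB fpcoefB fpcoefX_small ?subr0 //.
Qed.
Fact fps_unitPl F G : G * F = 1 -> F \in fps_unit.
Proof.
move=> GF1; rewrite inE; apply/unitrPr; exists (fpcoef G 0).
by rewrite mulrC -fpcoef0M GF1.
Qed.
Fact fps_inv_out : {in [predC fps_unit], fps_inv =1 id}.
Proof. by move=> F nuF; rewrite /fps_inv ifN. Qed.

HB.instance Definition _ := GRing.ComNzRing_hasMulInverse.Build (fps R)
  fps_mulV fps_unitPl fps_inv_out.

Definition fpsX : fps R := Fps (fun n => (n == 1%N)%:R).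

Lemma fpcoefXM F n :
  fpcoef (fpsX * F) n = if n is n'.+1 then fpcoef F n' else 0.
Proof.
case: n => [|n]; first by rewrite fpcoef0M mul0r.
rewrite fpcoefM big_ord_recl big_ord_recl /= mul0r mul1r add0r subSS subn0.
by rewrite big1 ?addr0 // => i _; rewrite mul0r.
Qed.

Lemma fpcoefXn k n : fpcoef (fpsX ^+ k) n = (n == k)%:R.
Proof.
by elim: k n => [|k IHk] [|n] //; rewrite exprS fpcoefXM ?IHk.
Qed.

Definition residue_part (d r : nat) F : fps R :=
  Fps (fun n => if (n == r %[mod d])%N then fpcoef F n else 0).

End FpsRing.

Notation "''t'" := (fpsX int) : ring_scope.

(* 'Z_N is Z/NZ only for 1 < N, and x_(i+1, j+1) is [steinhaus x i j]:
   both indices start from 0. *)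
Fixpoint steinhaus (N : nat) (x : nat -> 'Z_N) (i j : nat) : 'Z_N :=
  if i is i'.+1 then steinhaus x i' j + steinhaus x i' j.+1 else x j.

Definition multiplicity (N : nat) (s : seq 'Z_N) (v : 'Z_N) : nat :=
  (\sum_(i < size s) \sum_(j < size s - i) (steinhaus (nth 0%R s) i j == v))%N.

Definition balanced (N : nat) (s : seq 'Z_N) : bool :=
  [forall u, forall v, multiplicity s u == multiplicity s v].

Definition strongly_balanced (N : nat) (s : seq 'Z_N) : bool :=
  [forall t : 'I_(size s %/ (2 * N)).+1,
     balanced (take (size s - 2 * N * t)%N s)].

Definition quotZ (m : nat) (x : 'Z_(2 * m)) : 'Z_m := (x : nat)%:R.

Definition lift_count (m : nat) (S : nat -> 'Z_m) (n : nat) : nat :=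
  #|[set T : n.-tuple 'Z_(2 * m) |
      strongly_balanced T && (map (@quotZ m) T == mkseq S n)]|.

Definition gen_series (m : nat) (S : nat -> 'Z_m) : fps int :=
  Fps (fun n => (lift_count S n)%:R).

(* The infinite sequence u w w w ... *)
Definition evper (u w : seq 'Z_2) (n : nat) : 'Z_2 :=
  if (n < size u)%N then u`_n else w`_((n - size u) %% size w)%N.

(* The lifts of Q1, ..., Q4 are followed along the lengths congruent to 0
   modulo 8, and those of R1, ..., R12 along the lengths congruent to 7: the
   usual formulas only record that residue class, whereas [gen_series] counts
   every length, in particular the empty lift at n = 0. *)
Definition Q1 := evper [:: 0; 1; 0; 0]
  [:: 0; 0; 1; 0; 0; 1; 0; 1; 1; 1; 0; 0].
Definition Q2 := evper [::]
  [:: 0; 1; 0; 0; 1; 0; 0; 0; 0; 1; 1; 1].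
Definition Q3 := evper [:: 0; 1; 0; 1]
  [:: 0; 1; 1; 0; 0; 0; 0; 1; 1; 0; 0; 0].
Definition Q4 := evper [:: 0; 1; 0; 1]
  [:: 1; 0; 1; 0; 0; 0; 1; 0; 1; 0; 0; 0].
Definition R1 := evper [:: 0; 0; 1]
  [:: 0; 1; 0; 0; 0; 0; 1; 0; 0; 0; 0; 1].
Definition R2 := evper [:: 0; 0; 1; 1; 1; 1; 0]
  [:: 0; 0; 1; 1; 0; 1; 0; 1; 0; 1; 1; 0].
Definition R3 := evper [:: 0; 1; 0]
  [:: 0; 0; 0; 1; 0; 1; 0; 0; 0; 0; 1; 0].
Definition R4 := evper [:: 0; 1; 0; 0; 0; 0; 1]
  [:: 0; 1; 0; 0; 1; 0; 1; 1; 1; 1; 0; 0; 0; 0; 1; 0; 1; 0; 1; 1; 1; 1; 1; 1].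
Definition R5 := evper [:: 0; 1; 0; 0; 0; 0; 1]
  [:: 1; 0; 0; 1; 0; 0; 0; 0; 1; 0; 0; 1].
Definition R6 := evper [:: 0; 1; 0; 1; 0; 1; 1]
  [:: 0; 1; 0; 1; 0; 1; 1; 0; 0; 0; 1; 1].
Definition R7 := evper [:: 0; 1; 0; 1; 0; 1; 1]
  [:: 0; 1; 0; 1; 1; 1; 1; 1; 1; 1; 0; 1; 0; 1; 1; 0; 1; 0; 0; 1; 1; 1; 0; 1].
Definition R8 := evper [:: 0; 1; 0]
  [:: 1; 0; 1; 1; 1; 0; 1; 1; 0; 0; 1; 0].
Definition R9 := evper [:: 1; 0; 0]
  [:: 0; 0; 1; 0; 0; 0; 0; 1; 0; 1; 0; 0].
Definition R10 := evper [:: 1; 0; 0; 0; 0; 1; 0]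
  [:: 1; 1; 0; 0; 0; 1; 1; 0; 1; 0; 1; 0].
Definition R11 := evper [:: 1; 1; 1; 1; 1; 0; 1]
  [:: 0; 1; 1; 0; 0; 0; 1; 1; 0; 1; 0; 1].
Definition R12 := evper [:: 1; 1; 1]
  [:: 1; 1; 0; 1; 1; 0; 0; 0; 0; 1; 1; 1].

(* Main.v *)
(* A Steinhaus triangle of order n + 1 is one of order n plus an antidiagonal,
   which is the sequence of partial sums of the previous antidiagonal, started
   at the new term.  So the strongly balanced lifts can be grown eight terms at
   a time, remembering only the last antidiagonal: a block of eight terms is
   admissible iff the eight new antidiagonals contain each residue equally
   often.  Lengths not congruent to 0 or 7 modulo 8 carry no balanced triangle,
   since the number of entries must be a multiple of 4.

   Two lifts of the same block differ by twice a 0-1 sequence e, and the entry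
   in row k of the i-th new antidiagonal changes by twice the sum over s <= i of
   C(k, s) e_(i-s).  As s < 8, this has period 8 in k modulo 2; hence the counts
   of all 256 candidates can be read off the counts per row class modulo 8.

   The infinite branches are eventually of the form A W^k B on the
   antidiagonals, where W has length 24 and the terms added over 24 steps append
   one copy of W.  Along such a family every count is affine in k, so that one
   symbolic period decides all large k at once. *)

Require Import Defs.
From HB Require Import structures.
From mathcomp Require Import all_boot all_order all_algebra.
From mathcomp Require Import zify ring.

Set Implicit Arguments.
Unset Strict Implicit.
Unset Printing Implicit Defensive.

Import GRing.Theory.

Local Open Scope ring_scope.

(** * Antidiagonals over Z/4 and the search for admissible blocks *)

(** Residues modulo 4 as a bare enumeration: an element of ['Z_4] carries a bound proof, which would
    burden evaluation. *)
Inductive cell := C0 | C1 | C2 | C3.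

Definition cell_add a b := match a, b with
  | C0, c | c, C0 => c
  | C1, C1 => C2 | C1, C2 => C3 | C1, C3 => C0
  | C2, C1 => C3 | C2, C2 => C0 | C2, C3 => C1
  | C3, C1 => C0 | C3, C2 => C1 | C3, C3 => C2 end.

Definition cell_odd a := match a with C1 | C3 => true | C0 | C2 => false end.
Definition flip (b : bool) a := if b then cell_add C2 a else a.
Definition cell_of_bit (b : bool) := if b then C1 else C0.

Definition scan x d := x :: scanl cell_add x d.

Fixpoint strip d t :=
  if t is x :: t' then scan x d :: strip (scan x d) t' else [::].

(* A weight is represented by its action on an accumulator: only the constructors
   of [int] move, which keeps the evaluation by the kernel cheap. *)
Definition step := cell -> int -> int.
Definition inc (m : int) : int :=
  match m with Posz n => Posz n.+1 | Negz 0 => Posz 0 | Negz n.+1 => Negz n end.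
Definition dec (m : int) : int :=
  match m with Posz 0 => Negz 0 | Posz n.+1 => Posz n | Negz n => Negz n.+1 end.

Lemma incE m : inc m = m + 1. Proof. by case: m => [n|[|n]] /=; lia. Qed.
Lemma decE m : dec m = m - 1. Proof. by case: m => [[|n]|n] /=; lia. Qed.

Definition parity_step : step :=
  fun a => match a with C1 | C3 => inc | C0 | C2 => dec end.
Definition even_step : step :=
  fun a => match a with C0 => inc | C2 => dec | C1 | C3 => id end.
Definition odd_step : step :=
  fun a => match a with C1 => inc | C3 => dec | C0 | C2 => id end.

Definition additive_step (w : step) := forall a m, w a m = m + w a 0.
Definition alternating (w : step) := forall a, w (cell_add C2 a) 0 = - w a 0.

Lemma parity_stepD : additive_step parity_step.
Proof. by case=> m; rewrite /= ?incE ?decE; lia. Qed.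
Lemma even_stepD : additive_step even_step.
Proof. by case=> m; rewrite /= ?incE ?decE; lia. Qed.
Lemma odd_stepD : additive_step odd_step.
Proof. by case=> m; rewrite /= ?incE ?decE; lia. Qed.
Lemma even_stepN : alternating even_step. Proof. by case. Qed.
Lemma odd_stepN : alternating odd_step. Proof. by case. Qed.

Definition weight (w : step) l := foldl (fun m a => w a m) 0 l.

Section Weight.
Variables (w : step) (wD : additive_step w).

Lemma foldl_weight m l : foldl (fun m a => w a m) m l = m + weight w l.
Proof.
rewrite /weight; elim: l m => [|b l IHl] m /=; first by rewrite addr0.
by rewrite IHl [in RHS]IHl wD addrA.
Qed.

Lemma weight_cons a l : weight w (a :: l) = w a 0 + weight w l.
Proof. by rewrite {1}/weight /= foldl_weight. Qed.

Lemma weight_cat l1 l2 : weight w (l1 ++ l2) = weight w l1 + weight w l2.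
Proof.
by elim: l1 => [|a l1 IHl] /=; rewrite ?add0r // !weight_cons IHl addrA.
Qed.
End Weight.

(* #odd - #even, #0 - #2 and #1 - #3 vanish iff the four counts agree. *)
Definition equidistributed l :=
  [&& weight parity_step l == 0, weight even_step l == 0
    & weight odd_step l == 0].

(* Data attached to the eight row classes modulo 8. *)
Inductive oct (T : Type) := Oct of T & T & T & T & T & T & T & T.

Definition oct_false := Oct false false false false false false false false.

(* The pattern of changes in an antidiagonal is the [scan8] of the pattern in the
   previous one; it closes up with period 8 iff the latter is [closed8]. *)
Definition scan8 x0 o := let: Oct a b c d e f g h := o in
  let x1 := x0 (+) a in let x2 := x1 (+) b in let x3 := x2 (+) c in
  let x4 := x3 (+) d in let x5 := x4 (+) e in let x6 := x5 (+) f in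
  let x7 := x6 (+) g in Oct x0 x1 x2 x3 x4 x5 x6 x7.

Definition closed8 o := let: Oct a b c d e f g h := o in
  ~~ (a (+) b (+) c (+) d (+) e (+) f (+) g (+) h).

(** Rotating the octet at each cell takes the place of an index modulo 8. *)
Fixpoint perturb o l := if l is x :: l' then
    let: Oct a b c d e f g h := o in
    flip a x :: perturb (Oct b c d e f g h a) l'
  else [::].

(** Prefixing a cell shifts every row class by one, so class 7 of the tail becomes class 0. *)
Fixpoint class_weight (w : step) l := if l is x :: l' then
    let: Oct a b c d e f g h := class_weight w l' in Oct (w x h) a b c d e f g
  else Oct 0 0 0 0 0 0 0 0.

Fixpoint incs n m := if n is n'.+1 then incs n' (inc m) else m.
Fixpoint decs n m := if n is n'.+1 then decs n' (dec m) else m.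
Definition sub_if (b : bool) (x m : int) :=
  if b then match x with Posz n => decs n m | Negz n => incs n.+1 m end else m.

Definition sub_dot o (y : oct int) m :=
  let: Oct a b c d e f g h := o in let: Oct a' b' c' d' e' f' g' h' := y in
  sub_if a a' (sub_if b b' (sub_if c c' (sub_if d d' (sub_if e e'
    (sub_if f f' (sub_if g g' (sub_if h h' m))))))).

Fixpoint words n := if n is n'.+1 then
  map (cons false) (words n') ++ map (cons true) (words n') else [:: [::]].

(* [m] is half of a signed count of the unchanged strip; subtracting the class
   weights of all the changed cells leaves half of the count of the new one. *)
Fixpoint residue o e ys m := match e, ys with
  | b :: e', y :: ys' => let o' := scan8 b o in residue o' e' ys' (sub_dot o' y m)
  | _, _ => m end.

Definition is0 (m : int) := if m is Posz 0 then true else false.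

(** Depth first, so that candidates with a common prefix share its cost. *)
Fixpoint search o ys m := if ys is y :: ys' then
    let branch b :=
      let o' := scan8 b o in map (cons b) (search o' ys' (sub_dot o' y m)) in
    branch false ++ branch true
  else if is0 m then [:: [::]] else [::].

Fixpoint halfc n := if n is n'.+2 then (halfc n').+1 else 0.
(** Exact on even integers only: [Negz n] is -(n + 1), which is even when n is odd. *)
Definition halfz (m : int) : int :=
  match m with Posz n => Posz (halfc n) | Negz n => Negz (halfc n) end.

Definition evenz (m : int) :=
  match m with Posz n => ~~ odd n | Negz n => odd n end.

Definition base_lift s := map cell_of_bit s.

(** The excess of odd over even cells is common to all lifts of the block, hence tested once. The
    two signed counts change by even amounts, so they must start even; [search] then settles one of
    them and [residue] the other. *)
Definition fast_ext d s :=
  let ds := strip d (base_lift s) in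
  let m := weight even_step (flatten ds) in
  let m' := weight odd_step (flatten ds) in
  let h := halfz m in let h' := halfz m' in
  if [&& is0 (weight parity_step (flatten ds)), evenz m & evenz m'] then
    let ys' := map (class_weight odd_step) ds in
    [seq perturb (foldl (fun o b => scan8 b o) oct_false e) (last d ds)
    | e <- search oct_false (map (class_weight even_step) ds) h
    & is0 (residue oct_false e ys' h')]
  else [::].

Fixpoint lifts s := if s is b :: s' then
  map (cons (cell_of_bit b)) (lifts s') ++
    map (cons (flip true (cell_of_bit b))) (lifts s')
  else [:: [::]].

Definition ext d s :=
  [seq last d (strip d t) | t <- lifts s & equidistributed (flatten (strip d t))].

(** * Correctness of the fast search *)

Fixpoint twist e t := match e, t with
  | b :: e', x :: t' => flip b x :: twist e' t' | _, _ => [::] end.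

Fixpoint perturbs o e ds := match e, ds with
  | b :: e', d :: ds' => perturb (scan8 b o) d :: perturbs (scan8 b o) e' ds'
  | _, _ => [::] end.

Lemma liftsE s : lifts s = [seq twist e (base_lift s) | e <- words (size s)].
Proof.
elim: s => //= b s ->; rewrite map_cat -!map_comp.
by congr (_ ++ _); apply: eq_map.
Qed.

Lemma flip_cell_add b c x y :
  flip (b (+) c) (cell_add x y) = cell_add (flip b x) (flip c y).
Proof. by case: b; case: c; case: x; case: y. Qed.

(** Adding 2 twice does nothing, so changes propagate by exclusive or. Closedness makes the partial
    sums of the pattern return after eight rows, and is itself invariant under rotation. *)
Lemma scan_perturb o d b x : closed8 o ->
  scan (flip b x) (perturb o d) = perturb (scan8 b o) (scan x d).
Proof.
rewrite /scan; elim: d o b x => [|y d IHd] o b x /=.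
  by case: o.
case: o => a0 a1 a2 a3 a4 a5 a6 a7 clo; congr (_ :: _) => /=.
rewrite -flip_cell_add IHd; last first.
  by move: clo; case: a0; case: a1; case: a2; case: a3; case: a4; case: a5;
    case: a6; case: a7.
move: clo.
by case: b; case: a0; case: a1; case: a2; case: a3; case: a4; case: a5;
    case: a6; case: a7.
Qed.

Lemma mem_words e : e \in words (size e).
Proof.
by elim: e => //= b e IHe; rewrite mem_cat; case: b; rewrite map_f ?orbT.
Qed.

(* Only the patterns of the first seven antidiagonals are scanned again; that of
   the eighth involves C(k, 7), whose sum over a period can be odd. *)
Lemma closed8_foldl e : (size e < 8)%N ->
  closed8 (foldl (fun o b => scan8 b o) oct_false e).
Proof.
move=> lte; have: all (fun n => all (fun e => closed8
  (foldl (fun o b => scan8 b o) oct_false e)) (words n)) (iota 0 8) by [].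
move=> /allP/(_ (size e)); rewrite mem_iota => /(_ lte)/allP; apply.
exact: mem_words.
Qed.

Lemma perturb_false l : perturb oct_false l = l.
Proof. by elim: l => //= x l ->. Qed.

(** The prefix [e0] holds the bits already spent: every pattern still to be scanned comes from
    [oct_false] by fewer than eight scans, where [closed8_foldl] applies. *)
Lemma strip_twist e0 e d t : size e = size t -> (size e0 + size e <= 8)%N ->
  let o := foldl (fun o b => scan8 b o) oct_false e0 in
  strip (perturb o d) (twist e t) = perturbs o e (strip d t).
Proof.
elim: e e0 d t => [|b e IHe] e0 d [|x t] //= [szt] le8.
have lt8 : (size e0 < 8)%N by lia.
rewrite scan_perturb ?closed8_foldl //.
congr (_ :: _); have := IHe (rcons e0 b) (scan x d) t szt.
by rewrite size_rcons foldl_rcons; apply; lia.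
Qed.

Lemma last_perturbs o e ds d : size e = size ds ->
  last (perturb o d) (perturbs o e ds) =
    perturb (foldl (fun o b => scan8 b o) o e) (last d ds).
Proof. by elim: e o ds d => [|b e IHe] o [|d' ds] d //= [/IHe]. Qed.

Definition dot (o : oct bool) (y : oct int) : int :=
  let: Oct a b c d e f g h := o in let: Oct a' b' c' d' e' f' g' h' := y in
  a' *+ a + b' *+ b + c' *+ c + d' *+ d + e' *+ e + f' *+ f + g' *+ g + h' *+ h.

Lemma sub_ifE b x m : sub_if b x m = m - x *+ b.
Proof.
have incsE n y : incs n y = y + n%:Z.
  by elim: n y => [|n IHn] y /=; rewrite ?IHn ?incE; lia.
have decsE n y : decs n y = y - n%:Z.
  by elim: n y => [|n IHn] y /=; rewrite ?IHn ?decE; lia.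
by case: b x => [] [n|n]; rewrite /sub_if ?incsE ?decsE ?mulr1n ?mulr0n; lia.
Qed.

Lemma sub_dotE o y m : sub_dot o y m = m - dot o y.
Proof.
by case: o y => ? ? ? ? ? ? ? ? [? ? ? ? ? ? ? ?]; rewrite /= !sub_ifE; ring.
Qed.

Lemma search_residue o ys m :
  search o ys m = [seq e <- words (size ys) | is0 (residue o e ys m)].
Proof.
elim: ys o m => [|y ys IHys] o m //=.
by rewrite filter_cat !filter_map !IHys.
Qed.

Section Perturb.
Variables (w : step) (wD : additive_step w).

Lemma weight_perturb_even o l : (forall b a, w (flip b a) 0 = w a 0) ->
  weight w (perturb o l) = weight w l.
Proof.
move=> wF; elim: l o => //= x l IHl [? ? ? ? ? ? ? ?].
by rewrite !weight_cons // wF IHl.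
Qed.

Lemma weight_perturb o l : alternating w ->
  weight w (perturb o l) = weight w l - 2 * dot o (class_weight w l).
Proof.
move=> wN; elim: l o => [|x l IHl] [a0 a1 a2 a3 a4 a5 a6 a7] /=.
  by rewrite !mul0rn.
rewrite !weight_cons // IHl; case: (class_weight w l) => ? ? ? ? ? ? ? y /=.
rewrite (wD x y) mulrnDl; case: a0 => /=; rewrite ?wN ?mulr1n ?mulr0n; ring.
Qed.

Lemma weight_perturbs_even o e ds : (forall b a, w (flip b a) 0 = w a 0) ->
  size e = size ds ->
  weight w (flatten (perturbs o e ds)) = weight w (flatten ds).
Proof.
move=> wF; elim: e o ds => [|b e IHe] o [|d ds] //= [/IHe {}IHe].
by rewrite !weight_cat // weight_perturb_even // IHe.
Qed.

(** When [h] is half of the initial count, the first two terms cancel and twice the [residue]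
    remains. *)
Lemma weight_perturbs o e ds h : alternating w -> size e = size ds ->
  weight w (flatten (perturbs o e ds)) =
    weight w (flatten ds) - 2 * h + 2 * residue o e (map (class_weight w) ds) h.
Proof.
move=> wN; elim: e o ds h => [|b e IHe] o [|d ds] h //=.
  by rewrite addrNK.
move=> [/IHe {}IHe]; rewrite !weight_cat // weight_perturb //.
by rewrite sub_dotE (IHe _ (h - dot (scan8 b o) (class_weight w d))); ring.
Qed.
End Perturb.

Lemma parity_step_flip b a : parity_step (flip b a) 0 = parity_step a 0.
Proof. by case: b a => [] []. Qed.

Lemma is0E m : is0 m = (m == 0). Proof. by case: m => [[]|]. Qed.

Lemma size_strip d t : size (strip d t) = size t.
Proof. by elim: t d => //= x t IHt d; rewrite IHt. Qed.

Lemma halfcE n : halfc n = n./2.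
Proof.
have [m] := ubnP n; elim: m n => // m IHm [|[|n]] //= ltnm.
by rewrite IHm //; lia.
Qed.

Lemma evenzE m : evenz m = (m == halfz m + halfz m).
Proof. by case: m => n; rewrite /= halfcE; lia. Qed.

(** A lift with zero count forces the count of the base lift to be even, so the guard in [fast_ext]
    rejects no solution. *)
Lemma halfz_even m r : m - 2 * halfz m + 2 * r == 0 -> m = halfz m + halfz m.
Proof. by case: m => n; rewrite /= halfcE; lia. Qed.

(** Both sides enumerate the candidates in the order of [words], hence an equality of lists. The
    bound 8 is that of [strip_twist]. *)
Lemma fast_extE d s : (size s <= 8)%N -> fast_ext d s = ext d s.
Proof.
move=> le8; rewrite /fast_ext /ext; set ds := strip d (base_lift s).
have szds : size ds = size s by rewrite size_strip size_map.
have stripE e : e \in words (size s) ->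
    strip d (twist e (base_lift s)) = perturbs oct_false e ds /\ size e = size ds.
  move=> es; have sze: size e = size s.
    elim: (size s) e es => [|n IHn] e /=; first by rewrite inE => /eqP->.
    by rewrite mem_cat => /orP[] /mapP[e' /IHn <- ->].
  split; last by rewrite sze.
  have := @strip_twist [::] e d (base_lift s); rewrite /= perturb_false.
  apply => //.
    by rewrite size_map.
  by rewrite sze.
rewrite liftsE filter_map -map_comp search_residue size_map szds -filter_predI.
set h := halfz (weight even_step _); set h' := halfz (weight odd_step _).
have eqd e : e \in words (size s) ->
    equidistributed (flatten (strip d (twist e (base_lift s)))) =
    [&& weight parity_step (flatten ds) == 0,
        weight even_step (flatten ds) - 2 * h +
          2 * residue oct_false e (map (class_weight even_step) ds) h == 0
      & weight odd_step (flatten ds) - 2 * h' +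
          2 * residue oct_false e (map (class_weight odd_step) ds) h' == 0].
  move=> /stripE[-> sze]; rewrite /equidistributed.
  rewrite weight_perturbs_even ?sze //;
    [|exact: parity_stepD|exact: parity_step_flip].
  rewrite (weight_perturbs even_stepD _ h even_stepN sze).
  by rewrite (weight_perturbs odd_stepD _ h' odd_stepN sze).
rewrite is0E !evenzE -/h -/h'.
case: ifPn => [/and3P[/eqP p0 /eqP hm /eqP hm']|nC]; last first.
  rewrite (eq_in_filter (a2 := pred0)) ?filter_pred0 // => e es /=.
  rewrite eqd //; apply: contraNF nC => /and3P[-> c c'].
  by rewrite -/h -/h' {1}(halfz_even c) {1}(halfz_even c') !eqxx.
rewrite [in RHS](eq_in_filter (a2 := fun e =>
  is0 (residue oct_false e (map (class_weight odd_step) ds) h') &&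
  is0 (residue oct_false e (map (class_weight even_step) ds) h))) => [|e es].
  apply/eq_in_map => e; rewrite mem_filter => /andP[_ /stripE[/= -> sze]].
  by rewrite -{2}(perturb_false d) last_perturbs.
rewrite /= eqd // p0 eqxx /= !is0E hm hm'.
by rewrite andbC; congr (_ && _); lia.
Qed.

(** * Steinhaus triangles *)

Definition toZ c : 'Z_(2 * 2) :=
  match c with C0 => 0 | C1 => 1 | C2 => 2%:R | C3 => 3%:R end.
Definition ofZ (z : 'Z_(2 * 2)) : cell :=
  match val z with 0 => C0 | 1 => C1 | 2 => C2 | _ => C3 end%N.

Lemma toZK : cancel toZ ofZ. Proof. by case. Qed.
Lemma ofZK : cancel ofZ toZ.
Proof. by case=> -[|[|[|[|]]]] //= lt; apply/val_inj. Qed.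
Lemma toZD a b : toZ (cell_add a b) = toZ a + toZ b.
Proof. by case: a; case: b; apply/val_inj. Qed.

Definition cell_eqb a b :=
  match a, b with C0, C0 | C1, C1 | C2, C2 | C3, C3 => true | _, _ => false end.

Lemma cell_eqP : Equality.axiom cell_eqb.
Proof. by case; case; constructor. Qed.

HB.instance Definition _ := hasDecEq.Build cell cell_eqP.

Section Steinhaus.
Variable N : nat.
Implicit Types (s : seq 'Z_N) (x v : 'Z_N).

Lemma eq_steinhaus (f g : nat -> 'Z_N) i j :
  (forall k, (j <= k <= i + j)%N -> f k = g k) ->
  steinhaus f i j = steinhaus g i j.
Proof.
elim: i j => [|i IHi] j eqfg /=; first by apply: eqfg; lia.
by congr (_ + _); apply: IHi => k lek; apply: eqfg; lia.
Qed.

Definition diagonal s := foldl (fun d x => x :: scanl +%R x d) [::] s.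

Lemma size_diagonal s : size (diagonal s) = size s.
Proof.
elim/last_ind: s => //= s x IHs.
by rewrite /diagonal foldl_rcons /= size_scanl size_rcons -IHs.
Qed.

(** Going from cell k to cell k + 1 of the new antidiagonal adds cell k of the old one: this is the
    Steinhaus rule read along antidiagonals. *)
Lemma nth_diagonal s k : (k < size s)%N ->
  (diagonal s)`_k = steinhaus (nth 0 s) k (size s - k.+1).
Proof.
elim/last_ind: s k => //= s x IHs k.
rewrite /diagonal foldl_rcons -/(diagonal s) size_rcons ltnS.
elim: k => [|k IHk] lek /=.
  by rewrite subSS subn0 nth_rcons ltnn eqxx.
have ltk : (k < size s)%N by lia.
move: (IHk (ltnW lek)); rewrite nth_cons_scanl ?size_diagonal 1?ltnW // => IHk'.
rewrite nth_scanl ?size_diagonal // (take_nth 0) ?size_diagonal //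
  foldl_rcons IHk'.
rewrite IHs // addrC; congr (_ + _); last by congr steinhaus; lia.
(* An entry of the old antidiagonal does not involve the appended term. *)
rewrite subSS; apply: eq_steinhaus => j lej.
by rewrite nth_rcons (_ : (j < size s)%N) //; lia.
Qed.

(** Each old row gains one entry and a new row of one entry appears; together these are the last
    antidiagonal. *)
Lemma multiplicity_rcons s x v :
  multiplicity (rcons s x) v =
    (multiplicity s v + count_mem v (diagonal (rcons s x)))%N.
Proof.
rewrite /multiplicity size_rcons; under eq_bigr => i _.
  rewrite (_ : ((size s).+1 - i = (size s - i).+1)%N);
    last by have := ltn_ord i; lia.
  rewrite big_ord_recr /=; over.
rewrite big_split /= big_ord_recr /= subnn big_ord0 addn0; congr (_ + _)%N.
  apply: eq_bigr => i _; apply: eq_bigr => j _; congr (nat_of_bool (_ == v)).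
  apply: eq_steinhaus => k lek; have := ltn_ord i; have := ltn_ord j => ltj lti.
  by rewrite nth_rcons (_ : (k < size s)%N) //; lia.
rewrite -sum1_count [in RHS](big_nth 0) size_diagonal size_rcons big_mkord
  [RHS]big_mkcond /=.
apply: eq_bigr => i _; rewrite nth_diagonal ?size_rcons // subSS.
Qed.
End Steinhaus.

Definition last_diagonal t := last [::] (strip [::] t).
Definition triangle t := flatten (strip [::] t).

Lemma strip_cat d t t' :
  strip d (t ++ t') = strip d t ++ strip (last d (strip d t)) t'.
Proof. by elim: t d => //= x t IHt d; rewrite IHt. Qed.

Lemma last_strip_cat d t t' :
  last d (strip d (t ++ t')) =
    last (last d (strip d t)) (strip (last d (strip d t)) t').
Proof. by rewrite strip_cat last_cat. Qed.

Lemma toZ_last_diagonal t : map toZ (last_diagonal t) = diagonal (map toZ t).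
Proof.
elim/last_ind: t => // t x IHt; rewrite map_rcons /diagonal foldl_rcons.
rewrite -/(diagonal _) -IHt /last_diagonal -cats1 last_strip_cat /=.
congr (_ :: _); move: (last _ _) => d.
by elim: d x => //= y d IHd x; rewrite -toZD IHd.
Qed.

Lemma multiplicity_toZ t c :
  multiplicity (map toZ t) (toZ c) = count_mem c (triangle t).
Proof.
elim/last_ind: t => [|t x IHt]; first by rewrite /multiplicity big_ord0.
rewrite map_rcons multiplicity_rcons IHt -map_rcons -toZ_last_diagonal.
rewrite count_map /last_diagonal /triangle -cats1 strip_cat /= flatten_cat
  count_cat.
rewrite /= cats0 last_cat /=; congr (_ + _)%N.
by rewrite (can_eq toZK); congr (_ + _)%N; apply: eq_count => c';
  rewrite /= (can_eq toZK).
Qed.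

Lemma weight_count l :
  [/\ weight parity_step l = (count_mem C1 l)%:Z + (count_mem C3 l)%:Z
         - (count_mem C0 l)%:Z - (count_mem C2 l)%:Z,
      weight even_step l = (count_mem C0 l)%:Z - (count_mem C2 l)%:Z
    & weight odd_step l = (count_mem C1 l)%:Z - (count_mem C3 l)%:Z].
Proof.
elim: l => // c l [IHp IHe IHo].
rewrite !weight_cons ?IHp ?IHe ?IHo;
  [|exact: odd_stepD|exact: even_stepD|exact: parity_stepD].
by case: c => /=; split; lia.
Qed.

Lemma equidistributedP l :
  reflect (forall c c', count_mem c l = count_mem c' l) (equidistributed l).
Proof.
have [p e o] := weight_count l; rewrite /equidistributed p e o.
apply: (iffP and3P) => [[pl el ol]|eql].
  have c0 c : count_mem c l = count_mem C0 l by case: c; lia.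
  by move=> c c'; rewrite !c0.
by rewrite !(eql _ C0); split; lia.
Qed.

Lemma balanced_triangle t : balanced (map toZ t) = equidistributed (triangle t).
Proof.
apply/forallP/equidistributedP => [bal c c'|eql u].
  by rewrite -!multiplicity_toZ; apply/eqP/(forallP (bal _)).
by apply/forallP => v; rewrite -(ofZK u) -(ofZK v) !multiplicity_toZ (eql _
  (ofZ v)).
Qed.

(** Hence, beyond a balanced triangle, only the new antidiagonals have to be tested. *)
Lemma equidistributed_cat l1 l2 : equidistributed l1 ->
  equidistributed (l1 ++ l2) = equidistributed l2.
Proof.
rewrite /equidistributed !weight_cat;
  [|exact: odd_stepD|exact: even_stepD|exact: parity_stepD].
by case/and3P=> /eqP-> /eqP-> /eqP->; rewrite !add0r.
Qed.

Lemma strongly_balanced_short s : (size s < 8)%N -> strongly_balanced s =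
  @balanced (2 * 2) s.
Proof.
move=> lt8; apply/forallP/idP => [/(_ ord0)|bal [t /= ltt]].
  by rewrite muln0 subn0 take_size.
rewrite (_ : t = 0%N) ?muln0 ?subn0 ?take_size //.
by move: ltt; rewrite (divn_small lt8); lia.
Qed.

(** Since 8 = 2 * 4, removing 8(t + 1) terms from [s ++ e] is removing 8t terms from [s]; only t = 0
    gives a new condition. *)
Lemma strongly_balanced_cat s e : size e = 8%N ->
  strongly_balanced (s ++ e) = strongly_balanced s && @balanced (2 * 2) (s ++ e).
Proof.
move=> sze; have dE : ((size s + 8) %/ (2 * (2 * 2)) =
  (size s %/ (2 * (2 * 2))).+1)%N by lia.
apply/forallP/andP => [bal|[/forallP bals bal] [t /= ltt]].
  split.
    apply/forallP => -[t /= ltt].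
    have ltt' : (t.+1 < (size (s ++ e) %/ (2 * (2 * 2))).+1)%N.
      by rewrite size_cat sze dE.
    have := bal (Ordinal ltt'); rewrite /= size_cat sze.
    rewrite (_ : (size s + 8 - 2 * (2 * 2) * t.+1 =
      size s - 2 * (2 * 2) * t)%N); last by lia.
    by rewrite takel_cat // leq_subr.
  by have := bal ord0; rewrite muln0 subn0 take_size.
case: t ltt => [|t] ltt; first by rewrite muln0 subn0 take_size.
move: ltt; rewrite size_cat sze dE ltnS => ltt.
rewrite (_ : (size s + 8 - 2 * (2 * 2) * t.+1 = size s - 2 * (2 * 2) * t)%N);
  last by lia.
by rewrite takel_cat ?leq_subr //; apply: (bals (Ordinal ltt)).
Qed.

(** * Strongly balanced lifts *)

Lemma mem_lifts t s : (t \in lifts s) = (map cell_odd t == s).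
Proof.
elim: s t => [|b s IHs] [|x t] //=.
  by rewrite mem_cat; apply/negP => /orP[] /mapP[].
rewrite mem_cat eqseq_cons -IHs; apply/orP/andP => [[] /mapP[t' tin [-> ->]]|[]].
- by case: b.
- by case: b.
by case: b; case: x => // _ tin; (left + right); apply: (map_f (cons _) tin).
Qed.

Lemma uniq_lifts s : uniq (lifts s).
Proof.
elim: s => //= b s IHs; rewrite cat_uniq !map_inj_uniq ?IHs //;
  [|by move=> ? ? []..].
by rewrite andbT; apply/hasPn => _ /mapP[t _ ->]; apply/mapP => -[t' _]; case: b.
Qed.

Lemma lifts_cat s s' : lifts (s ++ s') = [seq t ++ t' | t <- lifts s,
  t' <- lifts s'].
Proof.
elim: s => /= [|b s ->]; first by rewrite cats0 map_id.
rewrite map_cat flatten_cat !map_flatten -!map_comp.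
by congr (flatten _ ++ flatten _); apply: eq_map => t /=; rewrite -!map_comp.
Qed.

Definition valid_lifts s := [seq t <- lifts s | strongly_balanced (map toZ t)].
(** Later blocks depend on a lift only through its last antidiagonal; one is kept per valid lift, so
    the length counts lifts. *)
Definition level s := [seq last_diagonal t | t <- valid_lifts s].
Definition next_level ds s := flatten [seq ext d s | d <- ds].

Lemma valid_lifts_cat s s' : size s' = 8%N ->
  valid_lifts (s ++ s') =
    [seq t ++ t' | t <- valid_lifts s,
       t' <- [seq t' <- lifts s' | equidistributed (flatten (strip
         (last_diagonal t) t'))]].
Proof.
move=> szs'; rewrite /valid_lifts lifts_cat filter_flatten.
elim: (lifts s) => //= t ts IHts; rewrite {}IHts filter_map.
have st' t' : t' \in lifts s' -> strongly_balanced (map toZ (t ++ t')) =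
    strongly_balanced (map toZ t) && equidistributed (flatten (strip
      (last_diagonal t) t')).
  rewrite mem_lifts => /eqP st'; rewrite map_cat strongly_balanced_cat;
    last first.
    by rewrite size_map -(size_map cell_odd) st'.
  case: (boolP (strongly_balanced _)) => //= sbt.
  rewrite -map_cat balanced_triangle /triangle strip_cat flatten_cat
    equidistributed_cat //.
  rewrite -/(triangle t) -balanced_triangle.
  (* The case t = 0 of strong balance: the triangle of the prefix is itself balanced. *)
  by have /forallP/(_ ord0) := sbt; rewrite muln0 subn0 take_size.
rewrite (eq_in_filter st'); case: ifP => //= _.
by rewrite filter_pred0.
Qed.

Lemma level_cat s s' : size s' = 8%N -> level (s ++ s') = next_level (level s) s'.
Proof.
move=> szs'; rewrite /level /next_level valid_lifts_cat // map_allpairs -map_comp.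
congr flatten; apply: eq_map => t /=; rewrite /ext.
by apply: eq_map => t'; rewrite /last_diagonal last_strip_cat.
Qed.

Lemma level_short s : (size s < 8)%N -> level s = ext [::] s.
Proof.
move=> lt8; congr map; apply: eq_in_filter => t; rewrite mem_lifts => /eqP st.
rewrite strongly_balanced_short ?balanced_triangle //.
by rewrite size_map -(size_map cell_odd) st.
Qed.

Definition parities (S : nat -> 'Z_2) n := S n == 1.

(** The tuples counted by [lift_count] correspond to valid lists of cells under [toZ], with
    [cell_odd] in the role of [quotZ]. *)
Lemma lift_countE (S : nat -> 'Z_2) n :
  lift_count S n = size (level (mkseq (parities S) n)).
Proof.
rewrite /lift_count size_map cardE -(size_map val).
rewrite -(size_map (map toZ) (valid_lifts _)).
apply: perm_size; apply: uniq_perm.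
- by rewrite (map_inj_uniq val_inj) enum_uniq.
- by rewrite map_inj_uniq ?filter_uniq ?uniq_lifts //;
  apply/inj_map/(can_inj toZK).
pose bit (b : bool) : 'Z_2 := b%:R.
have bit_inj : injective bit by case=> -[].
have bitE (z : 'Z_2) : bit (z == 1) = z by case: z => -[|[]] //= ?;
  apply: val_inj.
have quotE t : (map (@quotZ 2) (map toZ t) == mkseq S n) =
    (t \in lifts (mkseq (parities S) n)).
  rewrite mem_lifts -(inj_eq (inj_map bit_inj)) -!map_comp.
  rewrite (eq_map (g := bit \o cell_odd)); last by case; apply/val_inj.
  by congr (_ == _); apply: eq_map => k; rewrite /= bitE.
move=> u; apply/mapP/mapP => [[T]|[t]].
  rewrite mem_enum inE => /andP[sbT qT] ->.
  have TE : val T = map toZ (map ofZ T) by rewrite (mapK ofZK).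
  exists (map ofZ T) => //.
  by rewrite mem_filter -TE sbT -quotE -TE.
rewrite mem_filter -quotE => /andP[sbt qt] ->.
have szt : size (map toZ t) == n.
  by rewrite -(size_map (@quotZ 2)) (eqP qt) size_mkseq.
by exists (Tuple szt) => //; rewrite mem_enum inE /= sbt.
Qed.

(** Removing blocks of eight terms leads to a length n from 1 to 6, for which n(n + 1)/2 is never a
    multiple of 4. *)
Lemma level_eq_nil n s :
  size s = n -> (n %% 8 \notin [:: 0; 7])%N -> level s = [::].
Proof.
elim/ltn_ind: n s => n IHn s szs n8.
case: (ltnP n 8) => [lt8|le8]; last first.
  rewrite -(cat_take_drop (n - 8) s) level_cat; last by rewrite size_drop; lia.
  rewrite (IHn (n - 8)%N) ?size_takel //; try lia.
  by move: n8; rewrite -{1}(subnK le8) modnDr.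
rewrite level_short ?szs // /ext (eq_in_filter (a2 := pred0)) ?filter_pred0 //
  => t.
rewrite mem_lifts => /eqP st; apply/negP => /equidistributedP eqt.
have szt : size t = n by rewrite -szs -st size_map.
have size4 l : size l = (count_mem C0 l + count_mem C1 l + count_mem C2 l +
  count_mem C3 l)%N.
  by elim: l => //= -[] l ->; rewrite /=; lia.
have := size4 (flatten (strip [::] t));
  rewrite (eqt C1 C0) (eqt C2 C0) (eqt C3 C0).
have {}szs d t' : size (flatten (strip d t')) =
  (size t' * size d + 'C((size t').+1, 2))%N.
  elim: t' d => //= x t' IHt d; rewrite size_cat IHt /= size_scanl [in RHS]binS
    bin1 mulnS mulSn; lia.
rewrite szs szt; case: n n8 lt8 {IHn szt} => [|[|[|[|[|[|[|[|n]]]]]]]] //= _ _;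
  rewrite ?binE /=; lia.
Qed.

(** * Families of antidiagonals *)

(* [(A, W, B)] stands for the antidiagonals [A ++ W ^ k ++ B], for all [k]. *)
Definition family := (seq cell * seq cell * seq cell)%type.

Definition member k (F : family) :=
  let: (A, W, B) := F in A ++ flatten (nseq k W) ++ B.

(** Raising the exponent by one is expressed on the triple itself, so that it can be compared with a
    computed family. *)
Definition grow (F : family) : family := let: (A, W, B) := F in (A, W, W ++ B).

Lemma member_grow k F : member k (grow F) = member k.+1 F.
Proof.
case: F => [[A W] B]; rewrite /member /grow; congr (_ ++ _); rewrite catA.
congr (_ ++ B); elim: k => /= [|k IHk]; first by rewrite cats0.
by rewrite -catA IHk.
Qed.

(** The partial sums over the copies of [W] repeat only if [W] sums to zero; otherwise the result is
    [None]. Each [belast] leaves the boundary value to the next segment, so [A] and [W] keep their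
    lengths and [B] gains a cell. *)
Definition family_scan x (F : family) : option family :=
  let: (A, W, B) := F in let a := foldl cell_add x A in
  if foldl cell_add a W == a then
    Some (belast x (scanl cell_add x A), belast a (scanl cell_add a W), scan a B)
  else None.

Lemma scan_cat x l1 l2 :
  scan x (l1 ++ l2) = belast x (scanl cell_add x l1) ++
    scan (foldl cell_add x l1) l2.
Proof. by rewrite /scan; elim: l1 x => //= y l1 IHl x; rewrite IHl. Qed.

Lemma family_scanP x F F' k : family_scan x F = Some F' ->
  scan x (member k F) = member k F'.
Proof.
case: F => [[A W] B] /=; case: eqP => // WA [<-] /=.
rewrite scan_cat; congr (_ ++ _); move: (foldl _ x A) WA => a Wa.
by elim: k => //= k IHk; rewrite -!catA scan_cat Wa IHk.
Qed.

(* [(m, p)] is the function [k |-> m + k * p]. *)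
Definition affine := (int * int)%type.

Definition add_weight (w : step) (mp : affine) (F : family) : affine :=
  let: (A, W, B) := F in let: (m, p) := mp in
  let wl := foldl (fun m a => w a m) in (wl (wl m A) B, wl p W).

Definition value (k : nat) (mp : affine) : int := mp.1 + k%:Z * mp.2.

Lemma value_add_weight w mp F k : additive_step w ->
  value k (add_weight w mp F) = value k mp + weight w (member k F).
Proof.
move=> wD; case: F mp => [[A W] B] [m p]; rewrite /value /= !foldl_weight //.
rewrite !weight_cat //.
have -> : weight w (flatten (nseq k W)) = k%:Z * weight w W.
  elim: k => [|k IHk] /=; first by rewrite mul0r.
  by rewrite weight_cat // IHk intS; ring.
by ring.
Qed.

Definition always0 (mp : affine) := (mp.1 == 0) && (mp.2 == 0).
Definition never0 k0 mp :=
  (0 < value k0 mp) && (0 <= mp.2) || (value k0 mp < 0) && (mp.2 <= 0).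

Lemma always0P k mp : always0 mp -> value k mp = 0.
Proof. by case: mp => m p /andP[/= /eqP-> /eqP->]; rewrite /value mulr0. Qed.

Lemma never0P k0 k mp : never0 k0 mp -> (k0 <= k)%N -> (value k mp == 0) = false.
Proof.
case: mp => m p; rewrite /never0 /value /= => nev le0k; apply/negbTE.
by rewrite -(subnK le0k) PoszD mulrDl; nia.
Qed.

(** A leaf is decided for all k >= [k0] at once: either the three counts vanish identically, or one
    is nonzero at [k0] and does not move towards zero. Any other leaf, or a scan that loses the
    shape, makes the whole search fail. *)
Fixpoint family_search k0 F s (p e o : affine) : option (seq family) :=
  if s is b :: s' then
    let branch x := if family_scan x F is Some F' then
        family_search k0 F' s' (add_weight parity_step p F')
          (add_weight even_step e F') (add_weight odd_step o F')
      else None in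
    if branch (cell_of_bit b) is Some Gs then
      omap (cat Gs) (branch (flip true (cell_of_bit b)))
    else None
  else if [&& always0 p, always0 e & always0 o] then Some [:: F]
  else if [|| never0 k0 e, never0 k0 o | never0 k0 p] then Some [::] else None.

(** The accumulators are arbitrary, as the induction on the block needs: they hold the counts of the
    antidiagonals already passed. *)
Lemma family_searchP k0 F s p e o Gs k :
  family_search k0 F s p e o = Some Gs -> (k0 <= k)%N ->
  [seq last (member k F) (strip (member k F) t) | t <- lifts s &
     [&& value k p + weight parity_step (flatten (strip (member k F) t)) == 0,
         value k e + weight even_step (flatten (strip (member k F) t)) == 0
       & value k o + weight odd_step (flatten (strip (member k F) t)) == 0]] =
  map (member k) Gs.
Proof.
move=> + le0k; elim: s F p e o Gs => [|b s IHs] F p e o Gs /=.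
  rewrite !addr0; case: ifP => [/and3P[p0 e0 o0] [<-]|_].
    by rewrite !always0P.
  case: ifP => // nev [<-].
  by case/or3P: nev => /never0P/(_ le0k)->; rewrite ?andbF.
pose branch x := if family_scan x F is Some F' then
    family_search k0 F' s (add_weight parity_step p F')
      (add_weight even_step e F') (add_weight odd_step o F')
  else None.
suff branchP x Hs : branch x = Some Hs ->
  [seq last (member k F) (strip (member k F) t) | t <- map (cons x) (lifts s) &
     [&& value k p + weight parity_step (flatten (strip (member k F) t)) == 0,
         value k e + weight even_step (flatten (strip (member k F) t)) == 0
       & value k o + weight odd_step (flatten (strip (member k F) t)) == 0]] =
  map (member k) Hs.
  rewrite -/(branch (cell_of_bit b)) -/(branch _).
  case B1: (branch (cell_of_bit b)) => [Hs|] //;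
    case B2: (branch _) => [Ks|] //= [<-].
  by rewrite filter_cat map_cat (branchP _ _ B1) (branchP _ _ B2) map_cat.
rewrite /branch; case Fx: (family_scan x F) => [F'|] // /IHs <-.
have stripE t : strip (member k F) (x :: t) =
  member k F' :: strip (member k F') t.
  by rewrite -(family_scanP k Fx).
rewrite filter_map -map_comp.
rewrite (eq_map (g := fun t => last (member k F') (strip (member k F') t)));
  last first.
  by move=> t; rewrite /comp stripE.
congr map; apply: eq_filter => t.
pose Q l := [&& value k p + weight parity_step (flatten l) == 0,
  value k e + weight even_step (flatten l) == 0
  & value k o + weight odd_step (flatten l) == 0].
rewrite -[LHS]/(Q (strip (member k F) (x :: t))) stripE /Q [flatten _]/=.
by rewrite !weight_cat ?value_add_weight ?addrA //;
  first [exact: parity_stepD | exact: even_stepD | exact: odd_stepD].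
Qed.

Definition family_ext k0 F s := family_search k0 F s (0, 0) (0, 0) (0, 0).

Lemma family_extP k0 F s Gs k : family_ext k0 F s = Some Gs -> (k0 <= k)%N ->
  ext (member k F) s = map (member k) Gs.
Proof.
move=> FG le0k; rewrite -(family_searchP FG le0k) /value /= mulr0 addr0.
by congr map; apply: eq_filter => t; rewrite !add0r.
Qed.

Fixpoint family_level k0 Fs s : option (seq family) :=
  if Fs is F :: Fs' then
    if family_ext k0 F s is Some Gs then
      omap (cat Gs) (family_level k0 Fs' s)
    else None
  else Some [::].

Lemma family_levelP k0 Fs s Gs k :
  family_level k0 Fs s = Some Gs -> (k0 <= k)%N ->
  next_level (map (member k) Fs) s = map (member k) Gs.
Proof.
move=> + le0k; elim: Fs Gs => [|F Fs IHFs] Gs /=; first by case=> <-.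
case Fx: (family_ext k0 F s) => [Hs|] //;
  case Fl: (family_level k0 Fs s) => [Ks|] //= [<-].
by rewrite /next_level /= (family_extP Fx) // map_cat -(IHFs _ Fl).
Qed.

(** * Symmetry under negation *)

Definition cell_opp a := match a with C1 => C3 | C3 => C1 | _ => a end.
Definition opp_diag := map cell_opp.

Lemma cell_oppK : involutive cell_opp. Proof. by case. Qed.

Lemma strip_opp d t : strip (opp_diag d) (opp_diag t) = map opp_diag (strip d t).
Proof.
have addN a b : cell_add (cell_opp a) (cell_opp b) = cell_opp (cell_add a b).
  by case: a; case: b.
have scanN x l : scan (cell_opp x) (opp_diag l) = opp_diag (scan x l).
  by elim: l x => //= y l IHl x; rewrite /scan /= addN; congr (_ :: _);
    apply: IHl.
by elim: t d => //= x t IHt d; rewrite scanN IHt.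
Qed.

Lemma equidistributed_opp l : equidistributed (opp_diag l) = equidistributed l.
Proof.
have cN k (c : cell) : count_mem c (opp_diag k) = count_mem (cell_opp c) k.
  by rewrite count_map; apply: eq_count => a; case: a; case: c.
apply/equidistributedP/equidistributedP => eql c c'.
  by have := eql (cell_opp c) (cell_opp c'); rewrite !cN !cell_oppK.
by rewrite !cN.
Qed.

(** Negation preserves parities and equidistribution, so it permutes the admissible lifts of [s]; it
    changes their order, whence [perm_eq]. *)
Lemma ext_opp d s : perm_eq (ext (opp_diag d) s) (map opp_diag (ext d s)).
Proof.
have liftsN : perm_eq (lifts s) (map opp_diag (lifts s)).
  apply: uniq_perm; rewrite ?uniq_lifts ?map_inj_uniq ?uniq_lifts //.
    exact/inj_map/(inv_inj cell_oppK).
  move=> t; apply/idP/mapP => [ts|[t' + ->]].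
    exists (opp_diag t); last by rewrite /opp_diag mapK //; apply: cell_oppK.
    by move: ts; rewrite !mem_lifts -map_comp; congr (_ == _); apply: eq_map;
      case.
  by rewrite !mem_lifts -map_comp; congr (_ == _); apply: eq_map; case.
apply: perm_trans (perm_map _ (perm_filter _ liftsN)) _.
rewrite filter_map -!map_comp.
rewrite (eq_filter (a2 := fun t => equidistributed (flatten (strip d t)))).
  rewrite (eq_map (g := opp_diag \o (fun t => last d (strip d t)))) // => t.
  by rewrite /comp strip_opp last_map.
by move=> t; rewrite /= strip_opp -map_flatten equidistributed_opp.
Qed.

Lemma next_level_cat ds ds' s :
  next_level (ds ++ ds') s = next_level ds s ++ next_level ds' s.
Proof. by rewrite /next_level map_cat flatten_cat. Qed.

Lemma perm_next_level ds ds' s :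
  perm_eq ds ds' -> perm_eq (next_level ds s) (next_level ds' s).
Proof. by move=> dsP; apply/perm_flatten/perm_map. Qed.

Lemma next_level_opp ds s :
  perm_eq (next_level (map opp_diag ds) s) (map opp_diag (next_level ds s)).
Proof.
elim: ds => //= d ds IHds; rewrite /next_level /= map_cat.
by apply: perm_cat => //; apply: ext_opp.
Qed.

(* After 24 steps, each member is the next member of its own family. *)
Definition stable k0 Fs s s' s'' :=
  if family_level k0 Fs s is Some Gs then
    if family_level k0 Gs s' is Some Hs then
      [&& family_level k0 Hs s'' == Some (map grow Fs),
          size Gs == size Fs & size Hs == size Fs]
    else false
  else false.

(** * Levels along one residue class of lengths *)

Definition block (b : nat -> bool) r j := mkseq (fun i => b (r + 8 * j + i)%N) 8.

Section Levels.
Variables (b : nat -> bool) (r j1 : nat) (lev : nat -> seq (seq cell)).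
Hypothesis levS : forall j, (j1 <= j)%N ->
  lev j.+1 = next_level (lev j) (block b r j).

(** Three blocks make up 24 terms, a period of [b], and raise every exponent by one; so a single
    check at [j0] repeats for ever. The size tests in [stable] cover the two intermediate levels. *)
Lemma stable_levels k0 Fs j0 :
  (forall n, (7 <= n)%N -> b (n + 24)%N = b n) -> (0 < j0)%N -> (j1 <= j0)%N ->
  lev j0 = map (member k0) Fs ->
  stable k0 Fs (block b r j0) (block b r j0.+1) (block b r j0.+2) ->
  forall j, (j0 <= j)%N -> size (lev j) = size Fs.
Proof.
move=> per j0_gt0 le10 lev0; rewrite /stable.
case FG: (family_level _ _ _) => [Gs|] //;
  case GH: (family_level _ _ _) => [Hs|] //.
case/and3P=> /eqP HF /eqP sG /eqP sH.
(* As [0 < j0], the indices involved are at least 8, where [b] is already periodic. *)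
have blockD q i : (j0 <= q)%N -> block b r (q + 3 * i) = block b r q.
  move=> leq; elim: i => [|i IHi]; first by rewrite muln0 addn0.
  rewrite -IHi; apply/eq_map => n; rewrite -[RHS]per; last by lia.
  by congr b; lia.
have F3 i : lev (j0 + 3 * i) = map (member (k0 + i)%N) Fs.
  elim: i => [|i IHi]; first by rewrite muln0 !addn0.
  rewrite (_ : j0 + 3 * i.+1 = (j0 + 3 * i).+3)%N; last by lia.
  rewrite !levS ?IHi -?addSn ?blockD; try lia.
  rewrite (family_levelP FG) ?leq_addr // (family_levelP GH) ?leq_addr //.
  rewrite (family_levelP HF) ?leq_addr // -map_comp addnS.
  by apply: eq_map => F; apply: member_grow.
move=> j /subnKC <-; rewrite (divn_eq (j - j0) 3) mulnC addnA.
have := ltn_pmod (j - j0) (isT : 0 < 3)%N; case: (_ %% 3)%N => [|[|[|]]] // _.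
- by rewrite addn0 F3 size_map.
- by rewrite addn1 levS ?F3 ?blockD ?(family_levelP FG) ?size_map //; lia.
rewrite addn2 !levS ?F3 -?addSn ?blockD; try lia.
by rewrite (family_levelP FG) ?leq_addr // (family_levelP GH) ?leq_addr ?size_map.
Qed.
End Levels.

Definition fast_next_level ds s := flatten [seq fast_ext d s | d <- ds].

Fixpoint trace ds ss := if ss is s :: ss' then
    let: (ns, ds') := trace (fast_next_level ds s) ss' in (size ds :: ns, ds')
  else ([::], ds).

Lemma fast_next_levelE ds s :
  (size s <= 8)%N -> fast_next_level ds s = next_level ds s.
Proof. by move=> le8; congr flatten; apply: eq_map => d; rewrite fast_extE. Qed.

Lemma trace_levels b r lev j n :
  (forall i, (j <= i)%N -> lev i.+1 = next_level (lev i) (block b r i)) ->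
  trace (lev j) [seq block b r i | i <- iota j n] =
    ([seq size (lev i) | i <- iota j n], lev (j + n)%N).
Proof.
elim: n j => [|n IHn] j levS /=; first by rewrite addn0.
rewrite fast_next_levelE ?size_mkseq // -levS // IHn ?addnS // => i lti.
by rewrite levS // ltnW.
Qed.

Definition level_at b r j := level (mkseq b (r + 8 * j)).

Lemma level_atS b r j :
  level_at b r j.+1 = next_level (level_at b r j) (block b r j).
Proof.
rewrite /level_at -level_cat ?size_mkseq //; congr level.
rewrite mulnS (addnC 8) addnA /mkseq iotaD map_cat add0n; congr (_ ++ _).
by rewrite -[X in iota X]addn0 iotaDl -map_comp.
Qed.

(** * Certificates *)

Definition evper_bit (u w : seq bool) n :=
  if (n < size u)%N then nth false u n else nth false w ((n - size u) %% size w).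

(** A guess: [W] is read off its supposed first copy, and [certificate] checks that exponent 9 gives
    [d] back. *)
Definition family_of d : family :=
  (take 8 d, take 24 (drop 8 d), drop (8 + 24 * 9) d).

(* One of T and -T: the first odd cell of an antidiagonal distinguishes them. *)
Definition half_level ds := [seq d <- ds | head C0 (filter cell_odd d) == C1].

(* Level 29 consists of antidiagonals of length 232 or 239, of the form
   A W^9 B with A of length 8.  A smaller exponent would not do: for Q3 and R9,
   extensions that leave the family occur at k = 7, and are seen at k = 8. *)
Definition certificate (u w : seq 'Z_2) r rs c :=
  let b := evper_bit (map (fun z => z == 1) u) (map (fun z => z == 1) w) in
  let ds0 := fast_ext [::] (mkseq b r) in
  let ds1 := fast_next_level ds0 (block b r 0) in
  let hs := half_level ds1 in
  let: (ns, ds) := trace hs [seq block b r i | i <- iota 1 28] in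
  let Fs := map family_of ds in
  [&& (size u <= 7)%N, (size w %| 24)%N, perm_eq ds1 (hs ++ map opp_diag hs),
      size ds0 :: map double ns == rs ++ nseq (29 - size rs) c,
      (size Fs).*2 == c, map (member 9) Fs == ds &
      stable 9 Fs (block b r 29) (block b r 30) (block b r 31)].

Lemma parities_evper u w :
  parities (evper u w) =1
    evper_bit (map (fun z => z == 1) u) (map (fun z => z == 1) w).
Proof.
have nth1 (s : seq 'Z_2) i : nth false (map (fun z => z == 1) s) i = (s`_i == 1).
  by elim: s i => [|z s IHs] [|i] /=.
by move=> n; rewrite /parities /evper /evper_bit !size_map !nth1; case: ifP.
Qed.

Lemma certificateP u w r rs c : certificate u w r rs c -> (r < 8)%N ->
  (size rs <= 29)%N ->
  forall j, lift_count (evper u w) (r + 8 * j) = nth c rs j.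
Proof.
rewrite /certificate; set b := evper_bit _ _ => cert ltr ler j.
rewrite lift_countE (eq_mkseq (parities_evper u w)) -/b -/(level_at b r j).
move: cert; have -> : fast_ext [::] (mkseq b r) = level_at b r 0.
  by rewrite /level_at muln0 addn0 fast_extE ?level_short ?size_mkseq // ltnW.
rewrite fast_next_levelE ?size_mkseq // -level_atS; set hs := half_level _.
(* Halving starts at level 1: for r = 0, level 0 is the empty antidiagonal alone, which is its own
   negative. *)
pose half n := foldl next_level hs [seq block b r i | i <- iota 1 n.-1].
have halfS n : (1 <= n)%N -> half n.+1 = next_level (half n) (block b r n).
  case: n => // n _; rewrite /half -[n.+2.-1]/(n.+1) -[X in iota 1 X]addn1.
  by rewrite iotaD map_cat foldl_cat /= add1n.
have -> : trace hs [seq block b r i | i <- iota 1 28] =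
    ([seq size (half i) | i <- iota 1 28], half 29).
  by rewrite -(trace_levels 28 halfS).
set ns1 := [seq size (half i) | i <- _].
case/and5P=> le7 w24 hsP /eqP ns /and3P[/eqP sc /eqP hlev stab].
(* The decomposition checked at level 1 persists, since negation commutes with [next_level] up to
   order. *)
have halfP n : (1 <= n)%N -> size (level_at b r n) = (size (half n)).*2.
  move=> n_gt0; have: perm_eq (level_at b r n) (half n ++ map opp_diag (half n)).
    elim: n n_gt0 => // -[_ _|n IHn _]; first exact: hsP.
    rewrite level_atS halfS //; apply: perm_trans (perm_next_level _ (IHn isT)) _.
    by rewrite next_level_cat perm_cat2l next_level_opp.
  by move/perm_size->; rewrite size_cat size_map addnn.
have per n : (7 <= n)%N -> b (n + 24)%N = b n.
  move=> le_n; rewrite /b /evper_bit !size_map !ltnNge (leq_trans le7)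
    ?(leq_trans le7 le_n) //=; last by lia.
  by case/dvdnP: w24 => q ->; rewrite -addnBAC ?(leq_trans le7) // addnC modnMDl.
(* Levels 0 to 28 are compared with [rs], padded by [c]; from level 29 on the families keep the size
   constant. *)
have [ltj|lej] := ltnP j 29.
  have -> : size (level_at b r j) = nth c (rs ++ nseq (29 - size rs) c) j.
    case: j ltj => [|j] ltj; rewrite -ns // -[RHS]/(nth c (map double ns1) j).
    have sz1 : size ns1 = 28 by rewrite size_map size_iota.
    rewrite halfP // (nth_map 0%N) ?sz1 // (nth_map 0%N) ?size_iota //.
    by rewrite nth_iota.
  by rewrite nth_cat nth_nseq; case: ltnP => // lerj;
    rewrite (nth_default _ lerj) if_same.
rewrite halfP; last by lia.
rewrite (stable_levels halfS per _ _ (esym hlev) stab) // sc.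
by rewrite nth_default // (leq_trans ler).
Qed.

(** * Power series *)

Fixpoint series8 r rs c : fps int := if rs is a :: rs' then
    a%:R * 't ^+ r + series8 r.+4.+4 rs' c
  else c%:R * 't ^+ r / (1 - 't ^+ 8).

(* [series8] added to [F] as a left-associated sum without vanishing tail: up to
   reduction, this is the way in which the formulas of the theorem are written. *)
Fixpoint add_series8 (F : fps int) r rs c := if rs is a :: rs' then
    add_series8 (F + a%:R * 't ^+ r) r.+4.+4 rs' c
  else if c is 0%N then F else F + c%:R * 't ^+ r / (1 - 't ^+ 8).

Lemma series8_nil r : series8 r [::] 0 = 0.
Proof. by rewrite /= mulr0n !mul0r. Qed.

Lemma add_series8E F r rs c : add_series8 F r rs c = F + series8 r rs c.
Proof.
elim: rs F r => [|a rs IHrs] F r; last by rewrite /= IHrs addrA.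
by case: c => //; rewrite series8_nil addr0.
Qed.

(** The formulas write the constant term as [1], not as a multiple of ['t ^+ 0]. *)
Lemma series8_1 rs c : series8 0 (1%N :: rs) c = add_series8 1 8 rs c.
Proof. by rewrite add_series8E /= mulr1n expr0 mulr1. Qed.

Lemma series8_cons r a rs c :
  series8 r (a :: rs) c = add_series8 (a%:R * 't ^+ r) r.+4.+4 rs c.
Proof. by rewrite add_series8E. Qed.

Definition series8E := (series8_nil, series8_1, series8_cons).

Lemma fpcoef_natM (F : fps int) a n : fpcoef (a%:R * F) n = a%:R * fpcoef F n.
Proof.
by rewrite !mulr_natl; elim: a => [|a IHa]; rewrite ?mulr0n // !mulrS fpcoefD IHa.
Qed.

Lemma fpcoefXnM k (F : fps int) n :
  fpcoef ('t ^+ k * F) n = if (k <= n)%N then fpcoef F (n - k) else 0.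
Proof.
elim: k n => [|k IHk] [|n]; rewrite ?expr0 ?mul1r ?subn0 //.
  by rewrite exprS -mulrA fpcoefXM.
by rewrite exprS -mulrA fpcoefXM IHk.
Qed.

Lemma fpcoef_series8 r rs c n : fpcoef (series8 r rs c) n =
  if (r <= n)%N && (n == r %[mod 8])%N then (nth c rs ((n - r) %/ 8))%:R else 0.
Proof.
elim: rs r n => [|a rs IHrs] r n; last first.
  rewrite series8_cons add_series8E fpcoefD fpcoef_natM fpcoefXn IHrs.
  have [->|neq] := eqVneq n r.
    rewrite subnn leqnn eqxx /= mulr1 ifF ?addr0 //.
    by apply/negbTE; rewrite negb_and -ltnNge ltnS (leq_trans _ (leq_addl 7 r)).
  have -> : (r.+4.+4 <= n)%N && (n == r.+4.+4 %[mod 8])%N =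
      (r <= n)%N && (n == r %[mod 8])%N.
    by apply/idP/idP; lia.
  rewrite mulr0 add0r; case: ifP => // /andP[le_rn nr].
  by rewrite (_ : (n - r) %/ 8 = ((n - r.+4.+4) %/ 8).+1)%N //; lia.
(* The geometric tail: multiplied by the unit [1 - 't ^+ 8], the series [G] telescopes to its first
   term. *)
pose G : fps int :=
  Fps (fun n => if (r <= n)%N && (n == r %[mod 8])%N then c%:R else 0).
suff GE : series8 r [::] c = G by rewrite GE /= nth_nil.
have u8 : 1 - 't ^+ 8 \is a @GRing.unit (fps int).
  suff: 1 - 't ^+ 8 \in @fps_unit int by [].
  by rewrite inE -[fpcoef _ 0]/(fpcoef (1 : fps int) 0 - fpcoef ('t ^+ 8) 0)
    fpcoef1 fpcoefXn.
apply: (mulIr u8); rewrite [series8 _ _ _]/(_ / _) divrK //; apply: fps_eqP => k.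
rewrite fpcoef_natM fpcoefXn mulrBr mulr1 (mulrC G) fpcoefB fpcoefXnM /=.
have [->|neq] := eqVneq k r.
  rewrite leqnn eqxx /= mulr1; case: ifP => [le8r|_]; last by rewrite subr0.
  by rewrite leqNgt ltn_subrL (leq_trans _ le8r) // subr0.
rewrite mulr0; case: (leqP 8 k) => le8k.
  suff -> : (r <= k - 8)%N && (k - 8 == r %[mod 8])%N =
      (r <= k)%N && (k == r %[mod 8])%N.
    by rewrite subrr.
  by apply/idP/idP; lia.
rewrite subr0 ifN //; lia.
Qed.

Lemma residue_series u w r rs c : (r < 8)%N -> (size rs <= 29)%N ->
  certificate u w r rs c ->
  residue_part 8 r (gen_series (evper u w)) = series8 r rs c.
Proof.
move=> ltr ler cert; apply: fps_eqP => n; rewrite fpcoef_series8 /=.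
case: eqP => [nr|_]; last by rewrite andbF.
have le_rn : (r <= n)%N by rewrite (divn_eq n 8) nr modn_small // leq_addl.
have -> : n = (r + 8 * (n %/ 8))%N.
  by rewrite {1}(divn_eq n 8) nr (modn_small ltr) addnC mulnC.
by rewrite leq_addr addKn mulKn // (certificateP cert).
Qed.

(** In the other six classes all coefficients vanish by [level_eq_nil]. *)
Lemma gen_series_residues (S : nat -> 'Z_2) :
  gen_series S =
    residue_part 8 0 (gen_series S) + residue_part 8 7 (gen_series S).
Proof.
apply: fps_eqP => n; rewrite fpcoefD /=.
have [n0|n0] := eqVneq (n %% 8)%N 0%N; first by rewrite n0 addr0.
have [n7|n7] := eqVneq (n %% 8)%N 7%N; first by rewrite add0r.
rewrite lift_countE (@level_eq_nil n) ?size_mkseq // !inE.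
by rewrite negb_or n0 n7.
Qed.

(** * Evaluation of the certificates for the sixteen sequences *)

Lemma series_Q1 :
  residue_part 8 0 (gen_series Q1) =
    series8 0 [:: 1; 8; 34; 58; 84; 88; 86; 82; 60; 36; 34; 28; 16] 2 /\
  residue_part 8 7 (gen_series Q1) =
    series8 7 [:: 10; 72] 0.
(* The evaluation runs the search up to level 29 and then one symbolic period. In class 7 the lifts
   die out, so there the list of families is empty. *)
Proof. by split; apply: residue_series; vm_compute. Qed.

Lemma series_Q2 :
  residue_part 8 0 (gen_series Q2) =
    series8 0 [:: 1; 4; 14; 32; 36; 48; 44; 26; 22; 8; 6; 4; 2] 0 /\
  residue_part 8 7 (gen_series Q2) =
    series8 7 [::] 0.
Proof. by split; apply: residue_series; vm_compute. Qed.

Lemma series_Q3 :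
  residue_part 8 0 (gen_series Q3) =
    series8 0 [:: 1; 8; 28; 46; 78; 124; 118; 96; 78; 60; 28; 20; 14; 10; 4; 6; 4;
      6; 4; 2; 2; 2; 2; 2; 2; 2; 4] 2 /\
  residue_part 8 7 (gen_series Q3) =
    series8 7 [:: 10; 64] 0.
Proof. by split; apply: residue_series; vm_compute. Qed.

Lemma series_Q4 :
  residue_part 8 0 (gen_series Q4) =
    series8 0 [:: 1; 8; 26; 42; 66; 62; 52; 36; 26; 12; 6] 0 /\
  residue_part 8 7 (gen_series Q4) =
    series8 7 [::] 0.
Proof. by split; apply: residue_series; vm_compute. Qed.

Lemma series_R1 :
  residue_part 8 0 (gen_series R1) =
    series8 0 [:: 1] 0 /\
  residue_part 8 7 (gen_series R1) =
    series8 7 [::] 0.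
Proof. by split; apply: residue_series; vm_compute. Qed.

Lemma series_R2 :
  residue_part 8 0 (gen_series R2) =
    series8 0 [:: 1] 0 /\
  residue_part 8 7 (gen_series R2) =
    series8 7 [::] 0.
Proof. by split; apply: residue_series; vm_compute. Qed.

Lemma series_R3 :
  residue_part 8 0 (gen_series R3) =
    series8 0 [:: 1; 8] 0 /\
  residue_part 8 7 (gen_series R3) =
    series8 7 [:: 10; 38; 70; 88; 76; 54; 44; 28; 16; 8; 4; 4; 4; 4; 4; 6; 4;
      6] 4.
Proof. by split; apply: residue_series; vm_compute. Qed.

Lemma series_R4 :
  residue_part 8 0 (gen_series R4) =
    series8 0 [:: 1; 8; 22] 0 /\
  residue_part 8 7 (gen_series R4) =
    series8 7 [:: 10; 52; 102; 136; 152; 118; 108; 80; 60; 32; 20; 8; 2] 0.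
Proof. by split; apply: residue_series; vm_compute. Qed.

Lemma series_R5 :
  residue_part 8 0 (gen_series R5) =
    series8 0 [:: 1; 10] 0 /\
  residue_part 8 7 (gen_series R5) =
    series8 7 [:: 10] 0.
Proof. by split; apply: residue_series; vm_compute. Qed.

Lemma series_R6 :
  residue_part 8 0 (gen_series R6) =
    series8 0 [:: 1; 8] 0 /\
  residue_part 8 7 (gen_series R6) =
    series8 7 [:: 10; 30; 66; 96; 96; 94; 66; 42; 24; 8; 2; 2] 0.
Proof. by split; apply: residue_series; vm_compute. Qed.

Lemma series_R7 :
  residue_part 8 0 (gen_series R7) =
    series8 0 [:: 1; 8; 42] 0 /\
  residue_part 8 7 (gen_series R7) =
    series8 7 [:: 10; 60; 138; 204; 304; 266; 246; 148; 64; 36; 14; 10; 8] 0.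
Proof. by split; apply: residue_series; vm_compute. Qed.

Lemma series_R8 :
  residue_part 8 0 (gen_series R8) =
    series8 0 [:: 1; 10] 0 /\
  residue_part 8 7 (gen_series R8) =
    series8 7 [:: 10] 0.
Proof. by split; apply: residue_series; vm_compute. Qed.

Lemma series_R9 :
  residue_part 8 0 (gen_series R9) =
    series8 0 [:: 1] 0 /\
  residue_part 8 7 (gen_series R9) =
    series8 7 [:: 10; 42; 80; 130; 164; 174; 126; 68; 38; 20; 22; 12; 2; 2; 2;
      2; 2;
      2; 2; 2; 2; 2; 2; 2; 2; 4] 2.
Proof. by split; apply: residue_series; vm_compute. Qed.

Lemma series_R10 :
  residue_part 8 0 (gen_series R10) =
    series8 0 [:: 1] 0 /\
  residue_part 8 7 (gen_series R10) =
    series8 7 [:: 10; 58; 98; 130; 160; 138; 132; 84; 64; 34; 14; 8; 6; 2; 2;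
      4] 2.
Proof. by split; apply: residue_series; vm_compute. Qed.

Lemma series_R11 :
  residue_part 8 0 (gen_series R11) =
    series8 0 [:: 1] 0 /\
  residue_part 8 7 (gen_series R11) =
    series8 7 [:: 4; 16; 26; 32; 30; 30; 26; 12; 8; 2] 0.
Proof. by split; apply: residue_series; vm_compute. Qed.

Lemma series_R12 :
  residue_part 8 0 (gen_series R12) =
    series8 0 [:: 1] 0 /\
  residue_part 8 7 (gen_series R12) =
    series8 7 [:: 4] 0.
Proof. by split; apply: residue_series; vm_compute. Qed.

Theorem theorem3 :
  (residue_part 8 0 (gen_series Q1) =
      1 + 8 * 't ^+ 8 + 34 * 't ^+ 16 + 58 * 't ^+ 24 + 84 * 't ^+ 32
      + 88 * 't ^+ 40 + 86 * 't ^+ 48 + 82 * 't ^+ 56 + 60 * 't ^+ 64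
      + 36 * 't ^+ 72 + 34 * 't ^+ 80 + 28 * 't ^+ 88 + 16 * 't ^+ 96
      + 2 * 't ^+ 104 / (1 - 't ^+ 8)) /\
   (residue_part 8 0 (gen_series Q2) =
      1 + 4 * 't ^+ 8 + 14 * 't ^+ 16 + 32 * 't ^+ 24 + 36 * 't ^+ 32
      + 48 * 't ^+ 40 + 44 * 't ^+ 48 + 26 * 't ^+ 56 + 22 * 't ^+ 64
      + 8 * 't ^+ 72 + 6 * 't ^+ 80 + 4 * 't ^+ 88 + 2 * 't ^+ 96) /\
   (residue_part 8 0 (gen_series Q3) =
      1 + 8 * 't ^+ 8 + 28 * 't ^+ 16 + 46 * 't ^+ 24 + 78 * 't ^+ 32
      + 124 * 't ^+ 40 + 118 * 't ^+ 48 + 96 * 't ^+ 56 + 78 * 't ^+ 64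
      + 60 * 't ^+ 72 + 28 * 't ^+ 80 + 20 * 't ^+ 88 + 14 * 't ^+ 96
      + 10 * 't ^+ 104 + 4 * 't ^+ 112 + 6 * 't ^+ 120 + 4 * 't ^+ 128
      + 6 * 't ^+ 136 + 4 * 't ^+ 144 + 2 * 't ^+ 152 + 2 * 't ^+ 160
      + 2 * 't ^+ 168 + 2 * 't ^+ 176 + 2 * 't ^+ 184 + 2 * 't ^+ 192
      + 2 * 't ^+ 200 + 4 * 't ^+ 208 + 2 * 't ^+ 216 / (1 - 't ^+ 8)) /\
   (residue_part 8 0 (gen_series Q4) =
      1 + 8 * 't ^+ 8 + 26 * 't ^+ 16 + 42 * 't ^+ 24 + 66 * 't ^+ 32
      + 62 * 't ^+ 40 + 52 * 't ^+ 48 + 36 * 't ^+ 56 + 26 * 't ^+ 64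
      + 12 * 't ^+ 72 + 6 * 't ^+ 80) /\
   (residue_part 8 7 (gen_series R1) = 0) /\
   (residue_part 8 7 (gen_series R2) = 0) /\
   (residue_part 8 7 (gen_series R3) =
      10 * 't ^+ 7 + 38 * 't ^+ 15 + 70 * 't ^+ 23 + 88 * 't ^+ 31
      + 76 * 't ^+ 39 + 54 * 't ^+ 47 + 44 * 't ^+ 55 + 28 * 't ^+ 63
      + 16 * 't ^+ 71 + 8 * 't ^+ 79 + 4 * 't ^+ 87 + 4 * 't ^+ 95
      + 4 * 't ^+ 103 + 4 * 't ^+ 111 + 4 * 't ^+ 119 + 6 * 't ^+ 127
      + 4 * 't ^+ 135 + 6 * 't ^+ 143 + 4 * 't ^+ 151 / (1 - 't ^+ 8)) /\
   (residue_part 8 7 (gen_series R4) =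
      10 * 't ^+ 7 + 52 * 't ^+ 15 + 102 * 't ^+ 23 + 136 * 't ^+ 31
      + 152 * 't ^+ 39 + 118 * 't ^+ 47 + 108 * 't ^+ 55 + 80 * 't ^+ 63
      + 60 * 't ^+ 71 + 32 * 't ^+ 79 + 20 * 't ^+ 87 + 8 * 't ^+ 95
      + 2 * 't ^+ 103) /\
   (residue_part 8 7 (gen_series R5) = 10 * 't ^+ 7) /\
   (residue_part 8 7 (gen_series R6) =
      10 * 't ^+ 7 + 30 * 't ^+ 15 + 66 * 't ^+ 23 + 96 * 't ^+ 31
      + 96 * 't ^+ 39 + 94 * 't ^+ 47 + 66 * 't ^+ 55 + 42 * 't ^+ 63
      + 24 * 't ^+ 71 + 8 * 't ^+ 79 + 2 * 't ^+ 87 + 2 * 't ^+ 95) /\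
   (residue_part 8 7 (gen_series R7) =
      10 * 't ^+ 7 + 60 * 't ^+ 15 + 138 * 't ^+ 23 + 204 * 't ^+ 31
      + 304 * 't ^+ 39 + 266 * 't ^+ 47 + 246 * 't ^+ 55 + 148 * 't ^+ 63
      + 64 * 't ^+ 71 + 36 * 't ^+ 79 + 14 * 't ^+ 87 + 10 * 't ^+ 95
      + 8 * 't ^+ 103) /\
   (residue_part 8 7 (gen_series R8) = 10 * 't ^+ 7) /\
   (residue_part 8 7 (gen_series R9) =
      10 * 't ^+ 7 + 42 * 't ^+ 15 + 80 * 't ^+ 23 + 130 * 't ^+ 31
      + 164 * 't ^+ 39 + 174 * 't ^+ 47 + 126 * 't ^+ 55 + 68 * 't ^+ 63
      + 38 * 't ^+ 71 + 20 * 't ^+ 79 + 22 * 't ^+ 87 + 12 * 't ^+ 95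
      + 2 * 't ^+ 103 + 2 * 't ^+ 111 + 2 * 't ^+ 119 + 2 * 't ^+ 127
      + 2 * 't ^+ 135 + 2 * 't ^+ 143 + 2 * 't ^+ 151 + 2 * 't ^+ 159
      + 2 * 't ^+ 167 + 2 * 't ^+ 175 + 2 * 't ^+ 183 + 2 * 't ^+ 191
      + 2 * 't ^+ 199 + 4 * 't ^+ 207 + 2 * 't ^+ 215 / (1 - 't ^+ 8)) /\
   (residue_part 8 7 (gen_series R10) =
      10 * 't ^+ 7 + 58 * 't ^+ 15 + 98 * 't ^+ 23 + 130 * 't ^+ 31
      + 160 * 't ^+ 39 + 138 * 't ^+ 47 + 132 * 't ^+ 55 + 84 * 't ^+ 63
      + 64 * 't ^+ 71 + 34 * 't ^+ 79 + 14 * 't ^+ 87 + 8 * 't ^+ 95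
      + 6 * 't ^+ 103 + 2 * 't ^+ 111 + 2 * 't ^+ 119 + 4 * 't ^+ 127
      + 2 * 't ^+ 135 / (1 - 't ^+ 8)) /\
   (residue_part 8 7 (gen_series R11) =
      4 * 't ^+ 7 + 16 * 't ^+ 15 + 26 * 't ^+ 23 + 32 * 't ^+ 31
      + 30 * 't ^+ 39 + 30 * 't ^+ 47 + 26 * 't ^+ 55 + 12 * 't ^+ 63
      + 8 * 't ^+ 71 + 2 * 't ^+ 79) /\
   (residue_part 8 7 (gen_series R12) = 4 * 't ^+ 7) /\
   (gen_series Q1 = residue_part 8 0 (gen_series Q1)
      + (10 * 't ^+ 7 + 72 * 't ^+ 15)) /\
   (gen_series Q2 = residue_part 8 0 (gen_series Q2)) /\
   (gen_series Q3 = residue_part 8 0 (gen_series Q3)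
      + (10 * 't ^+ 7 + 64 * 't ^+ 15)) /\
   (gen_series Q4 = residue_part 8 0 (gen_series Q4)) /\
   (gen_series R1 = residue_part 8 7 (gen_series R1) + 1) /\
   (gen_series R2 = residue_part 8 7 (gen_series R2) + 1) /\
   (gen_series R3 = residue_part 8 7 (gen_series R3)
      + (1 + 8 * 't ^+ 8)) /\
   (gen_series R4 = residue_part 8 7 (gen_series R4)
      + (1 + 8 * 't ^+ 8 + 22 * 't ^+ 16)) /\
   (gen_series R5 = residue_part 8 7 (gen_series R5)
      + (1 + 10 * 't ^+ 8)) /\
   (gen_series R6 = residue_part 8 7 (gen_series R6)
      + (1 + 8 * 't ^+ 8)) /\
   (gen_series R7 = residue_part 8 7 (gen_series R7)
      + (1 + 8 * 't ^+ 8 + 42 * 't ^+ 16)) /\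
   (gen_series R8 = residue_part 8 7 (gen_series R8)
      + (1 + 10 * 't ^+ 8)) /\
   (gen_series R9 = residue_part 8 7 (gen_series R9) + 1) /\
   (gen_series R10 = residue_part 8 7 (gen_series R10) + 1) /\
   (gen_series R11 = residue_part 8 7 (gen_series R11) + 1) /\
   (gen_series R12 = residue_part 8 7 (gen_series R12) + 1).
Proof.
split; first by rewrite (proj1 series_Q1) series8E.
split; first by rewrite (proj1 series_Q2) series8E.
split; first by rewrite (proj1 series_Q3) series8E.
split; first by rewrite (proj1 series_Q4) series8E.
split; first by rewrite (proj2 series_R1) series8E.
split; first by rewrite (proj2 series_R2) series8E.
split; first by rewrite (proj2 series_R3) series8E.
split; first by rewrite (proj2 series_R4) series8E.
split; first by rewrite (proj2 series_R5) series8E.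
split; first by rewrite (proj2 series_R6) series8E.
split; first by rewrite (proj2 series_R7) series8E.
split; first by rewrite (proj2 series_R8) series8E.
split; first by rewrite (proj2 series_R9) series8E.
split; first by rewrite (proj2 series_R10) series8E.
split; first by rewrite (proj2 series_R11) series8E.
split; first by rewrite (proj2 series_R12) series8E.
(* Only the left occurrence of the series is split; the complementary class contributes a
   polynomial. *)
split; first by rewrite {1}gen_series_residues (proj2 series_Q1) series8E.
split; first by rewrite {1}gen_series_residues (proj2 series_Q2) series8E addr0.
split; first by rewrite {1}gen_series_residues (proj2 series_Q3) series8E.
split; first by rewrite {1}gen_series_residues (proj2 series_Q4) series8E addr0.
(* For the remaining sequences the complementary class is that of 0, which contains the empty lift:
   hence the summand 1. *)
split; first by rewrite {1}gen_series_residues addrC (proj1 series_R1) series8E.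
split; first by rewrite {1}gen_series_residues addrC (proj1 series_R2) series8E.
split; first by rewrite {1}gen_series_residues addrC (proj1 series_R3) series8E.
split; first by rewrite {1}gen_series_residues addrC (proj1 series_R4) series8E.
split; first by rewrite {1}gen_series_residues addrC (proj1 series_R5) series8E.
split; first by rewrite {1}gen_series_residues addrC (proj1 series_R6) series8E.
split; first by rewrite {1}gen_series_residues addrC (proj1 series_R7) series8E.
split; first by rewrite {1}gen_series_residues addrC (proj1 series_R8) series8E.
split; first by rewrite {1}gen_series_residues addrC (proj1 series_R9) series8E.
split; first by rewrite {1}gen_series_residues addrC (proj1 series_R10) series8E.
split; first by rewrite {1}gen_series_residues addrC (proj1 series_R11) series8E.
by rewrite {1}gen_series_residues addrC (proj1 series_R12) series8E.
Qed.
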